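(* Let $n\in\mathbb{Z}$ and let $\pi_n$ be the group of the twist knot $J(2,2n)$. The conjugacy classes of non-acyclic irreducible representations $\rho:\pi_n\to \mathrm{SL}_2(\mathbb{C})$ are exactly given, via the parameters $x=\operatorname{tr}\rho(a)$ and $y=\operatorname{tr}\rho(ab)$, by $$x=y=1-2\cos\frac{2\pi l}{3n-1},\qquad l\in\mathbb{Z},\quad 0<l\le \frac{|3n-1|-1}{2}.$$
   Context: For $n\in\mathbb{Z}$, the group of the twist knot $J(2,2n)$ is $\pi_n=\pi_1(S^3-J(2,2n))=\langle a,b\mid aw^n=w^nb\rangle$, where $w=[a,b^{-1}]=ab^{-1}a^{-1}b$. Conjugacy classes of irreducible representations $\rho:\pi_n\to\mathrm{SL}_2(\mathbb{C})$ are determined by the pair $(x,y)=(\operatorname{tr}\rho(a),\operatorname{tr}\rho(ab))$. A representation $\rho$ is called acyclic if $H_i(\pi_n,\rho)=0$ for every $i$ (group homology with local coefficients in $\mathbb{C}^2$ on which $\pi_n$ acts through $\rho$), and non-acyclic otherwise. *)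

(* Defs.v *)
From HB Require Import structures.
From mathcomp Require Import all_boot all_order all_algebra.
From mathcomp Require Import finmap monalg.
From mathcomp Require Import generic_quotient boolp.

Set Implicit Arguments.
Unset Strict Implicit.
Unset Printing Implicit Defensive.

Import GRing.Theory Num.Theory.

Local Open Scope ring_scope.
Local Open Scope quotient_scope.

Notation word X := (seq (X * bool)).

(* The letter (x, true) is x and the letter (x, false) is x^-1. *)
Definition letter X (x : X) : word X := [:: (x, true)].

Definition winv X (u : word X) : word X :=
  rev [seq (l.1, ~~ l.2) | l <- u].

Definition wexp X (u : word X) (n : int) : word X :=
  match n with
  | Posz k => flatten (nseq k u)
  | Negz k => flatten (nseq k.+1 (winv u))
  end.

Section Presentation.
Variables (X : choiceType) (rel : word X -> word X -> Prop).

Inductive wcong : word X -> word X -> Prop :=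
| wcong_refl u : wcong u u
| wcong_sym u v : wcong u v -> wcong v u
| wcong_trans u v w : wcong u v -> wcong v w -> wcong u w
| wcong_cat u u' v v' : wcong u u' -> wcong v v' -> wcong (u ++ v) (u' ++ v')
| wcong_cancel x b : wcong [:: (x, b); (x, ~~ b)] [::]
| wcong_rel u v : rel u v -> wcong u v.

Definition wcongb (u v : word X) : bool := `[< wcong u v >].

Lemma wcongb_refl : reflexive wcongb.
Proof. by move=> u; apply/asboolP; exact: wcong_refl. Qed.

Lemma wcongb_sym : symmetric wcongb.
Proof. by move=> u v; apply/asboolP/asboolP => /wcong_sym. Qed.

Lemma wcongb_trans : transitive wcongb.
Proof.
by move=> v u w /asboolP uv /asboolP vw; apply/asboolP; exact: wcong_trans uv vw.
Qed.

Canonical wcongb_equiv := EquivRel wcongb wcongb_refl wcongb_sym wcongb_trans.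

(* The group <X | u = v for all u, v such that rel u v>. *)
Definition presented := {eq_quot wcongb}.

HB.instance Definition _ := Choice.on presented.

Definition presented_class (u : word X) : presented := \pi_({eq_quot wcongb}) u.
Definition presented_repr (g : presented) : word X := repr g.

Local Notation cls := presented_class.

Lemma presented_reprK : cancel presented_repr cls.
Proof. exact: reprK. Qed.

Lemma presented_classP u v : wcong u v <-> cls u = cls v.
Proof. by split=> [uv|/eqmodP/asboolP//]; apply/eqmodP/asboolP. Qed.

Lemma presented_classW (P : presented -> Prop) :
  (forall u, P (cls u)) -> forall g, P g.
Proof. by move=> Pcls g; rewrite -[g]presented_reprK. Qed.

Lemma wcong_repr u : wcong (presented_repr (cls u)) u.
Proof. by apply/presented_classP; rewrite presented_reprK. Qed.

Lemma winv_cat (u v : word X) : winv (u ++ v) = winv v ++ winv u.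
Proof. by rewrite /winv map_cat rev_cat. Qed.

Lemma winvK : involutive (@winv X).
Proof.
move=> u; rewrite /winv map_rev revK -map_comp map_id_in //.
by case=> x b _ /=; rewrite negbK.
Qed.

Lemma wcong_mulV u : wcong (u ++ winv u) [::].
Proof.
elim: u => [|[x b] u IHu]; first exact: wcong_refl.
rewrite -cat1s winv_cat -catA [u ++ _]catA.
apply: wcong_trans (wcong_cancel x b).
apply: (wcong_cat (wcong_refl [:: (x, b)])).
exact: (wcong_cat IHu (wcong_refl [:: (x, ~~ b)])).
Qed.

Lemma wcong_mulVl u : wcong (winv u ++ u) [::].
Proof. by rewrite -{2}[u]winvK; exact: wcong_mulV. Qed.

Definition presented_one : presented := cls [::].
Definition presented_inv (g : presented) : presented :=
  cls (winv (presented_repr g)).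
Definition presented_mul (g h : presented) : presented :=
  cls (presented_repr g ++ presented_repr h).

Lemma presented_mul_class u v : presented_mul (cls u) (cls v) = cls (u ++ v).
Proof. by apply/presented_classP; apply: wcong_cat; exact: wcong_repr. Qed.

Lemma presented_mulA : associative presented_mul.
Proof.
elim/presented_classW=> u; elim/presented_classW=> v; elim/presented_classW=> w.
by rewrite !presented_mul_class catA.
Qed.

Lemma presented_mul1g : left_id presented_one presented_mul.
Proof. by elim/presented_classW=> u; rewrite presented_mul_class. Qed.

Lemma presented_mulg1 : right_id presented_one presented_mul.
Proof. by elim/presented_classW=> u; rewrite presented_mul_class cats0. Qed.

Lemma presented_mulVg :
  left_inverse presented_one presented_inv presented_mul.
Proof.
move=> g; rewrite -{2}[g]presented_reprK presented_mul_class.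
by apply/presented_classP; exact: wcong_mulVl.
Qed.

Lemma presented_mulgV :
  right_inverse presented_one presented_inv presented_mul.
Proof.
move=> g; rewrite -{1}[g]presented_reprK presented_mul_class.
by apply/presented_classP; exact: wcong_mulV.
Qed.

HB.instance Definition _ := isGroup.Build presented presented_mulA
  presented_mul1g presented_mulg1 presented_mulVg presented_mulgV.

Definition presented_gen (x : X) : presented := cls (letter x).

End Presentation.

Section TwistKnotGroup.

(* The two generators are indexed by bool: a by true and b by false. *)
Let a : word bool := letter true.
Let b : word bool := letter false.

Definition twist_word : word bool := a ++ winv b ++ winv a ++ b.

Definition twist_rel (n : int) (u v : word bool) : Prop :=
  u = a ++ wexp twist_word n /\ v = wexp twist_word n ++ b.

Definition twist_group (n : int) : groupType := presented (twist_rel n).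

Definition twist_a (n : int) : twist_group n := presented_gen (twist_rel n) true.
Definition twist_b (n : int) : twist_group n := presented_gen (twist_rel n) false.

End TwistKnotGroup.

Section SpecialLinear.
Variable F : fieldType.

Record SL2 := MkSL2 { SL2val :> 'M[F]_2; _ : \det SL2val == 1 }.

HB.instance Definition _ := [isSub for SL2val].
HB.instance Definition _ := [Choice of SL2 by <:].

Implicit Types A B : SL2.

Lemma SL2_det A : \det A = 1.
Proof. exact/eqP/(valP A). Qed.

Lemma SL2_unit A : (A : 'M_2) \in unitmx.
Proof. by rewrite unitmxE SL2_det unitr1. Qed.

Fact SL2_one_subproof : \det (1%:M : 'M[F]_2) == 1.
Proof. by rewrite det1. Qed.

Fact SL2_mul_subproof A B : \det (A *m B) == 1.
Proof. by rewrite det_mulmx !SL2_det mulr1. Qed.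

Fact SL2_inv_subproof A : \det (invmx A) == 1.
Proof. by rewrite det_inv SL2_det invr1. Qed.

Definition SL2_one := MkSL2 SL2_one_subproof.
Definition SL2_mul A B := MkSL2 (SL2_mul_subproof A B).
Definition SL2_inv A := MkSL2 (SL2_inv_subproof A).

Fact SL2_mulA : associative SL2_mul.
Proof. by move=> A B C; apply: val_inj; rewrite /= mulmxA. Qed.

Fact SL2_mul1g : left_id SL2_one SL2_mul.
Proof. by move=> A; apply: val_inj; rewrite /= mul1mx. Qed.

Fact SL2_mulg1 : right_id SL2_one SL2_mul.
Proof. by move=> A; apply: val_inj; rewrite /= mulmx1. Qed.

Fact SL2_mulVg : left_inverse SL2_one SL2_inv SL2_mul.
Proof. by move=> A; apply: val_inj; rewrite /= mulVmx ?SL2_unit. Qed.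

Fact SL2_mulgV : right_inverse SL2_one SL2_inv SL2_mul.
Proof. by move=> A; apply: val_inj; rewrite /= mulmxV ?SL2_unit. Qed.

HB.instance Definition _ := isGroup.Build SL2
  SL2_mulA SL2_mul1g SL2_mulg1 SL2_mulVg SL2_mulgV.

End SpecialLinear.

Section Representations.
Variables (F : fieldType) (G : groupType).
Implicit Types rho : {multiplicative G -> SL2 F}.

(* Matrices act on the left on column vectors. *)
Definition irreducible_rep rho : Prop :=
  forall V : {vspace 'cV[F]_2},
    (forall g v, v \in V -> (rho g : 'M_2) *m v \in V) ->
    V = 0%VS \/ V = fullv.

Definition conjugate_rep rho rho' : Prop :=
  exists P : SL2 F, forall g, rho' g = (P * rho g * P^-1)%g.

End Representations.

Section GroupHomology.
Variables (F : fieldType) (G : groupType).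
Variable rho : {multiplicative G -> SL2 F}.

(* The inhomogeneous bar complex with coefficients in the left G-module F^2: *)
(* an i-chain is a finite sum of terms v (x) [g_1|...|g_i], encoded as a     *)
(* finitely supported function from i-tuples to F^2.                         *)
Definition chain (i : nat) := {malg 'cV[F]_2[i.-tuple G]}.

(* [g_2|...|g_(i+1)] *)
Definition face_first i (t : i.+1.-tuple G) : i.-tuple G :=
  [tuple tnth t (lift ord0 k) | k < i].

(* For 1 <= j <= i, face_succ (j - 1) merges the entries g_j and g_(j+1),    *)
(* while face_succ i drops the last entry g_(i+1).                           *)
Definition face_succ i (j : 'I_i.+1) (t : i.+1.-tuple G) : i.-tuple G :=
  [tuple if k < j then tnth t (widen_ord (leqnSn i) k)
         else if k == j :> nat then
           (tnth t (widen_ord (leqnSn i) k) * tnth t (lift ord0 k))%g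
         else tnth t (lift ord0 k) | k < i]%N.

(* As Z[G] acts on the coefficients from the left, the first face multiplies *)
(* the coefficient by g_1^-1.                                                *)
Definition boundary_term i (v : 'cV[F]_2) (t : i.+1.-tuple G) : chain i :=
  << (rho (thead t)^-1%g : 'M_2) *m v *g face_first t >>
  + \sum_(j < i.+1) << (-1) ^+ j.+1 *: v *g face_succ j t >>.

Definition boundary i (c : chain i.+1) : chain i :=
  \sum_(t <- msupp c) boundary_term c@_t t.

Definition is_cycle i : chain i -> Prop :=
  match i with
  | 0 => fun _ => True
  | _.+1 => fun c => boundary c = 0
  end.

Definition is_boundary i (c : chain i) : Prop := exists d, boundary d = c.

(* H_i(G, rho) = 0 for every i. *)
Definition acyclic : Prop := forall i (c : chain i), is_cycle c -> is_boundary c.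

End GroupHomology.

(* Main.v *)
Require Import Defs.
From HB Require Import structures.
From mathcomp Require Import all_boot all_order all_algebra.
From mathcomp Require Import finmap monalg ring lra zify.
From mathcomp Require Import boolp reals trigo complex.
From mathcomp Require classical_sets.

(* Put [v = b^-1 a], [w = a b^-1 a^-1 b].  The symplectic form identifies F^2 *)
(* with its dual, so that [rho] is acyclic iff its cohomology vanishes.       *)
(*                                                                            *)
(* Cohomology vanishes in degrees >= 3 because the presentation is            *)
(* aspherical: dually, every function on the group is the relator defect of   *)
(* some cochain, and solving for the latter amounts to finding a function     *)
(* which is equivariant under [v] and [w^n].  This is possible because these  *)
(* two elements generate a free group freely, which is seen on an explicit    *)
(* permutation representation.  In degrees 1 and 2 vanishing means that       *)
(*   E = (a^-1 - 1) + (b - 1) a^-1 w^n                                        *)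
(* is invertible: a derivation can be normalised to vanish at [w], and its    *)
(* value at [b] then lies in the kernel of E.                                 *)
(*                                                                            *)
(* With x = tr a, y = tr ab the relation reads [w^n = k (w + 1 - y)] and      *)
(*   det E = 2 (2 - x - k (y - 2) (x - x^2 + y)).                             *)
(* Comparing with [det w^n = 1], det E = 0 forces x = y and k x (x - 2) = 1.  *)
(* For x = 1 - (z + 1/z) the eigenvalues of [w] are z^3 and z^-3, and the     *)
(* condition on [k] says z^(3n) = z.                                          *)

Set Implicit Arguments.
Unset Strict Implicit.
Unset Printing Implicit Defensive.

Import Order.TTheory GRing.Theory Num.Theory.
Local Open Scope group_scope.

(** * Groups given by presentations *)

(** For [n != 0] the group is an HNN extension of the free group on v = b^-1 a and w, with stable
    letter b: b v b^-1 = w v, and the relation becomes b w^n b^-1 = (w v)^-1 w^n. So v and w^n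
    generate a free group ([seifert_hom_inj]), which makes the presentation aspherical
    ([defect_surj], [cohomology_ge3]). The cohomology of an irreducible rho is then that of the Fox
    complex V -> V^2 -> V with V = F^2, and H^0 = 0 by irreducibility. As w - 1 is invertible, the
    rest is decided by one 2 x 2 matrix, [fox_mx]: rho is acyclic iff it is invertible
    ([twist_acyclic], [twist_not_acyclic]). Homology and cohomology are compared through the
    invariant symplectic form ([acyclic_cohomology], [acyclic_derivation]). For [n = 0] the relation
    says a = b, and there is no irreducible representation ([twist_pair_neq0]).

    Irreducible representations are conjugate to a normal form with parameters m and u
    ([normal_form_ex]), fixed by the two traces up to the choice of m or 1/m; hence
    [conjugate_rep_trace]. On it the relation says that w^n is a multiple k of w + 1 - y
    ([twist_power_eq]), and [det_fox_pair_eq0] turns singularity of the Fox matrix into x = y and k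
    x (x - 2) = 1. Writing x = 1 - (z + 1/z) makes z^3 an eigenvalue of w, and the conditions become
    z^(3n-1) = 1 with z different from 1 and -1 ([power_eq_zeta], [zeta_power_eq]). Such z, up to
    inversion, are the roots of unity counted by l ([root_of_unity_cos], [cos_root_of_unity]). *)

Definition is_hom (G H : groupType) (f : G -> H) := {morph f : x y / x * y}.

Section Homs.
Variables (G H : groupType) (f : G -> H).
Hypothesis fM : is_hom f.

Lemma hom1 : f 1 = 1.
Proof. by apply: (mulgI (f 1)); rewrite -fM !mulg1. Qed.

Lemma homV g : f g^-1 = (f g)^-1.
Proof. by apply: (mulgI (f g)); rewrite -fM !mulgV hom1. Qed.

Lemma homX g k : f (g ^+ k) = f g ^+ k.
Proof. by elim: k => [|k IHk]; rewrite ?hom1 // !expgS fM IHk. Qed.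

Lemma hom_inj : (forall g, f g = 1 -> g = 1) -> injective f.
Proof.
by move=> f1 g h fgh; apply/divg1_eq/f1; rewrite fM homV fgh mulgV.
Qed.

End Homs.

Definition gexpz (G : groupType) (g : G) (n : int) : G :=
  match n with Posz k => g ^+ k | Negz k => g ^- k.+1 end.

Lemma hom_gexpz (G H : groupType) (f : G -> H) : is_hom f ->
  forall g n, f (gexpz g n) = gexpz (f g) n.
Proof. by move=> fM g [k|k]; rewrite /= ?(homV fM) (homX fM). Qed.

Lemma gexpzS (G : groupType) (g : G) (n : int) :
  gexpz g (n + 1)%R = gexpz g n * g.
Proof.
case: n => [k|[|k]]; rewrite ?NegzE.
- by rewrite -PoszD /= addn1 expgSr.
- by rewrite addrC subrr /= mulVg.
- rewrite -addn1 PoszD opprD addrNK -NegzE /=.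
  by rewrite addn0 (expgS g k.+1) invgM mulgVK.
Qed.

Section PresentedGroups.
Variables (X : choiceType) (rel : word X -> word X -> Prop).
Local Notation cls := (@presented_class X rel).
Local Notation gen := (@presented_gen X rel).

Lemma cls_cat u v : cls (u ++ v) = cls u * cls v.
Proof. by rewrite -presented_mul_class. Qed.

Lemma cls_winv u : cls (winv u) = (cls u)^-1.
Proof.
apply: (mulgI (cls u)); rewrite mulgV -cls_cat.
exact/presented_classP/wcong_mulV.
Qed.

Lemma cls_wexp u n : cls (wexp u n) = gexpz (cls u) n.
Proof.
have E v k : cls (flatten (nseq k v)) = cls v ^+ k.
  by elim: k => //= k IHk; rewrite cls_cat IHk expgS.
by case: n => k; rewrite /wexp E //= cls_winv expVgn.
Qed.

Definition weval (H : groupType) (h : X -> H) (u : word X) : H :=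
  foldr (fun l g => (if l.2 then h l.1 else (h l.1)^-1) * g) 1 u.

Lemma weval_cat (H : groupType) (h : X -> H) u v :
  weval h (u ++ v) = weval h u * weval h v.
Proof. by elim: u => /= [|l u ->]; rewrite ?mul1g ?mulgA. Qed.

Lemma weval_winv (H : groupType) (h : X -> H) u :
  weval h (winv u) = (weval h u)^-1.
Proof.
elim: u => [|[x b] u IHu]; first by rewrite invg1.
rewrite -cat1s winv_cat !weval_cat IHu invgM; congr (_ * _).
by case: b; rewrite /= !mulg1 ?invgK.
Qed.

Lemma weval_wexp (H : groupType) (h : X -> H) u n :
  weval h (wexp u n) = gexpz (weval h u) n.
Proof.
have E v k : weval h (flatten (nseq k v)) = weval h v ^+ k.
  by elim: k => //= k IHk; rewrite weval_cat IHk expgS.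
by case: n => k; rewrite /wexp E //= weval_winv expVgn.
Qed.

Lemma weval_wcong (H : groupType) (h : X -> H) :
  (forall u v, rel u v -> weval h u = weval h v) ->
  forall u v, wcong rel u v -> weval h u = weval h v.
Proof.
move=> hrel u v; elim=> {u v} //.
- by move=> u v w _ -> _.
- by move=> u u' v v' _ IHu _ IHv; rewrite !weval_cat IHu IHv.
- by move=> x [] /=; rewrite mulg1 ?mulgV ?mulVg.
Qed.

Lemma presented_lift (H : groupType) (h : X -> H) :
  (forall u v, rel u v -> weval h u = weval h v) ->
  exists2 f : presented rel -> H, is_hom f & forall x, f (gen x) = h x.
Proof.
move=> /weval_wcong hrel; pose f (g : presented rel) := weval h (presented_repr g).
have fcls u : f (cls u) = weval h u by apply: hrel; exact: wcong_repr.
exists f => [|x]; last by rewrite fcls /= mulg1.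
elim/presented_classW=> u; elim/presented_classW=> v.
by rewrite -cls_cat !fcls weval_cat.
Qed.

Lemma cls_weval u : cls u = weval gen u.
Proof.
elim: u => // -[x b] u IHu; rewrite -cat1s cls_cat IHu; congr (_ * _).
by case: b; rewrite //= -cls_winv.
Qed.

Lemma presented_ind (P : presented rel -> Prop) :
  P 1 -> (forall x g, P g -> P (gen x * g)) ->
  (forall x g, P g -> P ((gen x)^-1 * g)) -> forall g, P g.
Proof.
move=> P1 PM PV; elim/presented_classW=> u; rewrite cls_weval.
by elim: u => //= -[x []] u /=; [exact: PM | exact: PV].
Qed.

Lemma hom_eq (H : groupType) (f f' : presented rel -> H) :
  is_hom f -> is_hom f' -> (forall x, f (gen x) = f' (gen x)) -> f =1 f'.
Proof.
move=> fM f'M ff'; elim/presented_ind => [|x g IHg|x g IHg].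
- by rewrite !hom1.
- by rewrite fM f'M ff' IHg.
- by rewrite fM f'M !homV // ff' IHg.
Qed.

End PresentedGroups.

(** * Permutation groups of arbitrary types *)

Section SymmetricGroup.
Variable T : Type.

Record Sym := MkSym {
  sym_fun :> T -> T;
  sym_inv : T -> T;
  sym_funK : cancel sym_fun sym_inv;
  sym_invK : cancel sym_inv sym_fun }.

HB.instance Definition _ := gen_eqMixin Sym.
HB.instance Definition _ := gen_choiceMixin Sym.

Lemma symP (s t : Sym) : s =1 t -> s = t.
Proof.
move=> st; have inv_st : sym_inv s = sym_inv t.
  apply/funext=> x.
  by rewrite -{1}[x](sym_invK t) -st (sym_funK s).
case: s t st inv_st => [f f' fK f'K] [g g' gK g'K] /= /funext fg fg'.
by subst g g'; congr MkSym; exact: Prop_irrelevance.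
Qed.

Definition sym_one : Sym := @MkSym id id (fun=> erefl) (fun=> erefl).
Definition sym_mul (s t : Sym) : Sym :=
  @MkSym (s \o t) (sym_inv t \o sym_inv s)
    (can_comp (sym_funK s) (sym_funK t)) (can_comp (sym_invK t) (sym_invK s)).
Definition sym_invg (s : Sym) : Sym := MkSym (sym_invK s) (sym_funK s).

Fact sym_mulA : associative sym_mul. Proof. by move=> s t r; exact: symP. Qed.
Fact sym_mul1g : left_id sym_one sym_mul. Proof. by move=> s; exact: symP. Qed.
Fact sym_mulg1 : right_id sym_one sym_mul. Proof. by move=> s; exact: symP. Qed.
Fact sym_mulVg : left_inverse sym_one sym_invg sym_mul.
Proof. by move=> s; apply: symP; exact: sym_funK. Qed.
Fact sym_mulgV : right_inverse sym_one sym_invg sym_mul.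
Proof. by move=> s; apply: symP; exact: sym_invK. Qed.

HB.instance Definition _ := isGroup.Build Sym
  sym_mulA sym_mul1g sym_mulg1 sym_mulVg sym_mulgV.

Lemma symM (s t : Sym) x : (s * t) x = s (t x). Proof. by []. Qed.
Lemma symV (s : Sym) x y : s x = y -> s^-1 y = x.
Proof. by move=> <-; exact: sym_funK. Qed.

End SymmetricGroup.

Section LeftRegular.
Variable G : groupType.

Definition lreg_sym (g : G) : Sym G := MkSym (mulKg g) (mulVKg g).

Lemma lreg_sym_hom : is_hom lreg_sym.
Proof. by move=> g h; apply: symP => x /=; rewrite mulgA. Qed.

End LeftRegular.

(** * Coordinates with respect to the cosets of an embedded subgroup *)

Section Transversal.
Variables (K G : groupType) (i : K -> G).
Hypotheses (iM : is_hom i) (i_inj : injective i).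

Let orb (g g' : G) : bool := `[< exists h, g' = i h * g >].

(** A canonical representative of the coset i(K) g. Together with [coset_coord] it displays G as a
    free left K-set. *)
Definition coset_root (g : G) : G := choose (orb g) g.

Lemma coset_rootM h g : coset_root (i h * g) = coset_root g.
Proof.
have orbE : orb (i h * g) =1 orb g.
  move=> g'; apply/asboolP/asboolP => -[k ->].
    by exists (k * h); rewrite iM mulgA.
  by exists (k * h^-1); rewrite iM (homV iM) !mulgA mulgVK.
rewrite /coset_root (eq_choose orbE); apply: choose_id.
  by apply/asboolP; exists h.
by apply/asboolP; exists 1; rewrite (hom1 iM) mul1g.
Qed.

Lemma coset_coord_ex g : exists h, g = i h * coset_root g.
Proof.
have /asboolP[h ->] : orb g (coset_root g).
  by apply: chooseP; apply/asboolP; exists 1; rewrite (hom1 iM) mul1g.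
by exists h^-1; rewrite (homV iM) mulKg.
Qed.

Definition coset_coord (g : G) : K := sval (cid (coset_coord_ex g)).

Lemma coset_coordE g : i (coset_coord g) * coset_root g = g.
Proof. by rewrite /coset_coord; case: cid. Qed.

Lemma coset_coordM h g : coset_coord (i h * g) = h * coset_coord g.
Proof.
apply: i_inj; apply: (mulIg (coset_root g)).
by rewrite -[in LHS](coset_rootM h) coset_coordE iM -mulgA coset_coordE.
Qed.

End Transversal.

(** * The free group on two letters *)

Section FreeGroup.

Definition free_group : groupType :=
  presented (fun _ _ : word bool => False).

Definition fgen (x : bool) : free_group := presented_gen _ x.

Lemma free_lift (H : groupType) (h : bool -> H) :
  exists2 f : free_group -> H, is_hom f & forall x, f (fgen x) = h x.
Proof. exact: presented_lift. Qed.

Section CyclicRoot.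
Variables (k : nat) (z : free_group).
Local Notation T := (free_group * 'I_k.+1)%type.

(** The factor z is picked up only at the wrap-around, so a full turn of the cycle multiplies by z
    exactly once. *)
Let f (p : T) : T := (if p.2 == ord_max then z * p.1 else p.1, ordS p.2).
Let f' (p : T) : T := (if p.2 == ord0 then z^-1 * p.1 else p.1, ord_pred p.2).

Let ordS_eq0 (j : 'I_k.+1) : (ordS j == ord0) = (j == ord_max).
Proof.
apply/eqP/eqP => [/(congr1 val) /= /eqP|->]; last by apply: val_inj; rewrite /= modnn.
move=> jk; apply: val_inj => /=; apply/eqP; rewrite eqn_leq -ltnS ltn_ord /=.
by rewrite -ltnS dvdn_leq.
Qed.

Let fK : cancel f f'.
Proof.
move=> [x j]; rewrite /f /f' /= ordS_eq0 ordSK; congr (_, _).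
by case: eqP => _ //; rewrite mulKg.
Qed.

Let f'K : cancel f' f.
Proof.
move=> [x j]; rewrite /f /f' /= -ordS_eq0 ord_predK; congr (_, _).
by case: eqP => _ //; rewrite mulVKg.
Qed.

Definition cyclic_root : Sym T := MkSym fK f'K.

Lemma cyclic_rootX x : (cyclic_root ^+ k.+1) (x, ord0) = (z * x, ord0).
Proof.
have E j : (j <= k)%N -> (cyclic_root ^+ j) (x, ord0) = (x, inord j).
  elim: j => [|j IHj] jk; first by congr (_, _); apply: val_inj; rewrite /= inordK.
  rewrite expgS symM IHj 1?ltnW //= /f /= -val_eqE /= inordK 1?ltnW //.
  rewrite ltn_eqF //; congr (_, _); apply: val_inj => /=.
  by rewrite !inordK ?modn_small // ltnW.
rewrite expgS symM E //= /f /= -val_eqE /= inordK // eqxx; congr (_, _).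
by apply: val_inj; rewrite /= inordK // modnn.
Qed.

End CyclicRoot.

(* In the permutation group of free_group * Z/n, left multiplication by the *)
(* second generator acquires an n-th root.                                  *)
Lemma free_power_inj (n : int) (i : free_group -> free_group) : n != 0 ->
  is_hom i -> i (fgen true) = fgen true ->
  i (fgen false) = gexpz (fgen false) n -> injective i.
Proof.
move=> n0 iM it if_.
have [k [e nE]] : exists k (e : bool), forall (H : groupType) (g : H),
    gexpz g n = if e then g ^+ k.+1 else g ^- k.+1.
  by case: n n0 {if_} => [[|k]|k] // _; exists k; [exists true | exists false].
(* For negative n the root is taken of the inverse letter, so that the negative power still gives
   the letter itself. *)
pose z := if e then fgen false else (fgen false)^-1.
have [V VE] : exists V : Sym (free_group * 'I_k.+1),
    forall p, V p = (fgen true * p.1, p.2).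
  have [] : cancel (fun p : free_group * 'I_k.+1 => (fgen true * p.1, p.2))
          (fun p => ((fgen true)^-1 * p.1, p.2)) /\
     cancel (fun p : free_group * 'I_k.+1 => ((fgen true)^-1 * p.1, p.2))
          (fun p => (fgen true * p.1, p.2)).
    by split=> -[x j] /=; rewrite ?mulKg ?mulVKg.
  by move=> VK V'K; exists (MkSym VK V'K).
have [t tM tE] := free_lift (fun x => if x then V else cyclic_root k z).
(* On the slice [ord0] the image of [i h] acts as left multiplication by h, so h can be recovered
   from [i h]. *)
have tiE h : forall x, t (i h) (x, ord0) = (h * x, ord0).
  have tf (x : free_group) : t (i (fgen false)) (x, ord0) = (fgen false * x, ord0).
    rewrite if_ (hom_gexpz tM) tE nE; have := cyclic_rootX k z; rewrite /z.
    case: e {nE z tM tE} => tzX; first exact: tzX.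
    by apply: symV; rewrite tzX mulKg.
  have tg c (x : free_group) : t (i (fgen c)) (x, ord0) = (fgen c * x, ord0).
    by case: c => //; rewrite it tE VE.
  elim/presented_ind: h => [|c g IHg|c g IHg] x.
  - by rewrite (hom1 iM) (hom1 tM) mul1g.
  - by rewrite iM tM symM IHg tg mulgA.
  - rewrite iM tM symM IHg (homV iM) (homV tM).
    by apply: symV; rewrite tg !mulgA mulgV mul1g.
apply: (hom_inj iM) => h ih; have := tiE h 1; rewrite ih (hom1 tM) mulg1.
by case.
Qed.

End FreeGroup.

(** * A free subgroup of the twist knot group *)

Definition wcomm (H : groupType) (a b : H) : H := a * (b^-1 * (a^-1 * b)).

Section TwistGroup.
Variable n : int.
Local Notation G := (twist_group n).
Local Notation a := (twist_a n).
Local Notation b := (twist_b n).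

Definition twist_w : G := wcomm a b.

Lemma cls_twist_word : presented_class (twist_rel n) twist_word = twist_w.
Proof. by rewrite /twist_word !cls_cat !cls_winv. Qed.

Lemma twist_relE : a * gexpz twist_w n = gexpz twist_w n * b.
Proof.
rewrite -cls_twist_word -cls_wexp -!cls_cat.
by apply/presented_classP; apply: wcong_rel.
Qed.

Lemma twist_lift (H : groupType) (ha hb : H) :
  ha * gexpz (wcomm ha hb) n = gexpz (wcomm ha hb) n * hb ->
  exists f : G -> H, [/\ is_hom f, f a = ha & f b = hb].
Proof.
move=> hrel; pose h x := if x then ha else hb.
have [u v [-> ->]|f fM fE] := @presented_lift _ (twist_rel n) H h; last first.
  by exists f; split; rewrite // (fE true, fE false).
have E : weval h twist_word = wcomm ha hb.
  by rewrite /twist_word !weval_cat !weval_winv /= !mulg1.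
by rewrite !weval_cat weval_wexp E /= !mulg1.
Qed.

Lemma twist_ind (P : G -> Prop) :
  P 1 -> (forall g, P g -> P (a * g)) -> (forall g, P g -> P (b * g)) ->
  (forall g, P g -> P (a^-1 * g)) -> (forall g, P g -> P (b^-1 * g)) ->
  forall g, P g.
Proof.
by move=> P1 Pa Pb PVa PVb; apply: presented_ind => // -[] g;
  [exact: Pa | exact: Pb | exact: PVa | exact: PVb].
Qed.

(** The images of the two letters generate the subgroup that the stable letter b conjugates in the
    HNN decomposition. *)
Definition seifert_hom_spec (f : free_group -> G) :=
  [/\ is_hom f, f (fgen true) = b^-1 * a & f (fgen false) = gexpz twist_w n].

(* The permutation [B] below solves [B v = (s v) B] and                      *)
(* [B s^n = (s v)^-1 s^n B] among the permutations of the free group on      *)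
(* [v, s], the letters acting by left multiplication; then [a |-> B v],      *)
(* [b |-> B] is an action of the twist group in which [w] acts as [s].       *)
Lemma seifert_hom_inj f : n != 0 -> seifert_hom_spec f -> injective f.
Proof.
move=> n0 [fM f1 f0]; pose v := fgen true; pose s := fgen false.
have [i iM iE] := free_lift (fun x => if x then v else gexpz s n).
have iI : injective i by apply: (free_power_inj n0 iM); exact: iE.
(* [theta] and [eta] are automorphisms with inverses [theta'] and [eta']. Read through i, [eta]
   fixes v and turns s^n into v^-1 s^n; [theta] then turns v into s v. Together they prescribe
   conjugation by B on the image of i. *)
have [theta thM thE] := free_lift (fun x => if x then s * v else s).
have [theta' th'M th'E] := free_lift (fun x => if x then s^-1 * v else s).
have [eta etM etE] := free_lift (fun x => if x then v else v^-1 * s).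
have [eta' et'M et'E] := free_lift (fun x => if x then v else v * s).
have compM (g h : free_group -> free_group) : is_hom g -> is_hom h -> is_hom (g \o h).
  by move=> gM hM x y /=; rewrite hM gM.
have idM : is_hom (@id free_group) by [].
have thK : cancel theta theta'.
  apply: (hom_eq (compM _ _ th'M thM) idM) => x /=; rewrite -/(fgen x) thE.
  by case: x; rewrite ?th'M !th'E ?mulVKg.
have th'K : cancel theta' theta.
  apply: (hom_eq (compM _ _ thM th'M) idM) => x /=; rewrite -/(fgen x) th'E.
  by case: x; rewrite ?thM ?(homV thM) !thE ?mulKg.
have etK : cancel eta eta'.
  apply: (hom_eq (compM _ _ et'M etM) idM) => x /=; rewrite -/(fgen x) etE.
  by case: x; rewrite ?et'M ?(homV et'M) !et'E ?mulKg.
have et'K : cancel eta' eta.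
  apply: (hom_eq (compM _ _ etM et'M) idM) => x /=; rewrite -/(fgen x) et'E.
  by case: x; rewrite ?etM !etE ?mulVKg.
pose r := coset_root i; pose q := coset_coord iM.
(* Applying [eta] to the subgroup coordinate and keeping the coset representative extends
   [i h -> i (eta h)] to a permutation of the whole free group. *)
pose c g := i (eta (q g)) * r g; pose c' g := i (eta' (q g)) * r g.
have rM h g : r (i h * g) = r g by exact: coset_rootM.
have qM h g : q (i h * g) = h * q g by exact: coset_coordM.
have qrK g : i (q g) * r g = g by exact: coset_coordE.
have rr g : r (r g) = r g by rewrite -[in RHS](qrK g) rM.
have qr g : q (r g) = 1 by apply: (mulgI (q g)); rewrite -qM mulg1 qrK.
have cK : cancel c c' by move=> g; rewrite /c' /c rM qM rr qr mulg1 etK qrK.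
have c'K : cancel c' c by move=> g; rewrite /c' /c rM qM rr qr mulg1 et'K qrK.
have cE h g : c (i h * g) = i (eta h) * c g by rewrite /c qM rM etM iM mulgA.
pose B : Sym free_group := MkSym (can_comp thK cK) (can_comp c'K th'K).
pose L := @lreg_sym free_group.
have LM : is_hom L by exact: lreg_sym_hom.
have BL h : B * L (i h) = L (theta (i (eta h))) * B.
  by apply: symP => g; rewrite !symM /= cE thM.
have Bv : B * L v = L (s * v) * B by rewrite -[v in LHS](iE true) BL etE iE thE.
have Bs : B * L (gexpz s n) = L ((s * v)^-1 * gexpz s n) * B.
  rewrite -[gexpz s n in LHS](iE false) BL etE iM (homV iM) !iE thM (homV thM).
  by rewrite (hom_gexpz thM) !thE.
have wE : wcomm (B * L v) B = L s.
  by rewrite /wcomm Bv mulgA mulgK -Bv invgM mulgVK LM mulgK.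
have [|F [FM Fa Fb]] := @twist_lift (Sym free_group) (B * L v) B.
  rewrite wE -(hom_gexpz LM) -mulgA -LM.
  have -> : v * gexpz s n = i (fgen true * fgen false) by rewrite iM !iE.
  rewrite BL etM iM thM !etE !iE iM thM (homV iM) !iE (homV thM) (hom_gexpz thM) !thE.
  by rewrite mulVKg.
have Ff h : F (f h) = L (i h).
  move: h; apply: (@hom_eq _ _ _ (F \o f) (L \o i)) => [g h|g h|[]] /=.
  - by rewrite fM FM.
  - by rewrite iM LM.
  - by rewrite f1 FM (homV FM) Fa Fb mulKg iE.
  - rewrite f0 (hom_gexpz FM) iE (hom_gexpz LM) -wE; congr gexpz.
    by rewrite /twist_w /wcomm !FM !(homV FM) Fa Fb.
apply: (hom_inj fM) => h fh; apply: iI; rewrite (hom1 iM).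
by have := congr1 (fun s : Sym free_group => s 1) (Ff h); rewrite fh (hom1 FM) /= mulg1.
Qed.

Lemma seifert_hom_ex : exists f, seifert_hom_spec f.
Proof.
have [f fM fE] := free_lift (fun x => if x then b^-1 * a else gexpz twist_w n).
by exists f; split=> //; rewrite fE.
Qed.

End TwistGroup.

Local Close Scope group_scope.
Local Open Scope ring_scope.

(** * Vanishing of higher cohomology *)

Section Merge.
Variables (G : groupType) (V : zmodType).
Implicit Types (f : seq G -> V) (g h : G) (s : seq G).

(* The alternating sum of all faces of [g :: s] but the first one. *)
Fixpoint inner_faces f g s : V :=
  match s with
  | [::] => f [::]
  | h :: s' => f ((g * h)%g :: s') - inner_faces (fun t => f (g :: t)) h s'
  end.

Lemma eq_inner_faces f f' g s :
  (forall t, size t = size s -> f t = f' t) -> inner_faces f g s = inner_faces f' g s.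
Proof.
elim: s f f' g => [|h s IHs] f f' g ff' /=; first exact: ff'.
by rewrite ff' //=; congr (_ - _); apply: IHs => t ts; rewrite ff' //= ts.
Qed.

Lemma inner_facesB f f' g s :
  inner_faces (fun t => f t - f' t) g s = inner_faces f g s - inner_faces f' g s.
Proof.
elim: s f f' g => //= h s IHs f f' g; rewrite IHs !opprB addrACA [RHS]addrACA.
by congr (_ + _); rewrite addrC.
Qed.

Lemma inner_faces_morph (k : V -> V) f g s : {morph k : u v / u - v} ->
  inner_faces (fun t => k (f t)) g s = k (inner_faces f g s).
Proof. by move=> kB; elim: s f g => //= h s IHs f g; rewrite IHs -kB. Qed.

(** The cancellation behind the vanishing of a double coboundary. *)
Lemma inner_faces_inner_faces f g h s :
  inner_faces (inner_faces f g) h s = inner_faces f (g * h)%g s.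
Proof.
elim: s f g h => //= k s IHs f g h.
by rewrite mulgA inner_facesB IHs /= opprB addrA addrNK.
Qed.

End Merge.

Section Cochains.
Variables (G : groupType) (V : zmodType) (act : G -> V -> V).
Hypotheses (actB : forall g, {morph act g : u v / u - v}).
Hypotheses (actM : forall g h v, act (g * h)%g v = act g (act h v)).
Hypotheses (act1 : forall v, act 1%g v = v).
Implicit Types (g h x y : G) (s : seq G).

Lemma act0 g : act g 0 = 0.
Proof. by rewrite -[0 in LHS](subrr 0) actB subrr. Qed.

Lemma actN g v : act g (- v) = - act g v.
Proof. by rewrite -sub0r actB act0 sub0r. Qed.

Lemma actD g u v : act g (u + v) = act g u + act g v.
Proof. by rewrite -[v in LHS]opprK actB actN opprK. Qed.

Lemma actVK g v : act g^-1%g (act g v) = v.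
Proof. by rewrite -actM mulVg act1. Qed.

Lemma actKV g v : act g (act g^-1%g v) = v.
Proof. by rewrite -actM mulgV act1. Qed.

Definition cobound (f : seq G -> V) s : V :=
  if s is g :: t then act g (f t) - inner_faces f g t else 0.

(* The coboundary for the coefficients Map(G, V), on which g acts by *)
(* (g f)(x) = f (x g).                                               *)
Definition cobound_ind (f : G -> seq G -> V) x s : V :=
  if s is g :: t then f (x * g)%g t - inner_faces (f x) g t else 0.

Lemma eq_cobound_ind f f' i x s : (forall y t, size t = i -> f y t = f' y t) ->
  size s = i.+1 -> cobound_ind f x s = cobound_ind f' x s.
Proof.
case: s => //= g t ff' [ti]; rewrite ff' //; congr (_ - _).
by apply: eq_inner_faces => t'; rewrite ti => /ff'.
Qed.

Lemma cobound_indB f f' x s :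
  cobound_ind (fun y t => f y t - f' y t) x s
  = cobound_ind f x s - cobound_ind f' x s.
Proof.
case: s => [|g t] /=; first by rewrite subrr.
by rewrite inner_facesB !opprB addrACA [RHS]addrACA; congr (_ + _); rewrite addrC.
Qed.

Lemma cobound_ind_morph (k : V -> V) f x s : {morph k : u v / u - v} ->
  cobound_ind (fun y t => k (f y t)) x s = k (cobound_ind f x s).
Proof.
move=> kB; case: s => [|g t] /=; first by rewrite -[in RHS](subrr (0 : V)) kB subrr.
by rewrite inner_faces_morph // -kB.
Qed.

Lemma cobound_indK f x g h s :
  cobound_ind (cobound_ind f) x [:: g, h & s] = 0.
Proof.
rewrite /= inner_facesB inner_faces_inner_faces mulgA.
set p := f _ _; set q := inner_faces (f _) _ _.
set r := inner_faces _ _ _.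
by rewrite (opprB q) (addrA (p - r)) addrNK subrr.
Qed.

(* The contraction of the cochains with coefficients in Map(G, V). *)
Definition contract (f : G -> seq G -> V) x s := f 1%g (x :: s).

Lemma cobound_ind_contract f x g s :
  cobound_ind f 1%g [:: x, g & s] = 0 ->
  cobound_ind (contract f) x (g :: s) = f x (g :: s).
Proof.
by rewrite /= mul1g => /subr0_eq ->.
Qed.

End Cochains.

(** * Fox calculus as integration along words *)

Section WordIntegral.
Variables (X : choiceType) (rel : word X -> word X -> Prop) (V : zmodType).
Local Notation G := (presented rel).
Local Notation cls := (@presented_class X rel).
Local Notation gen := (@presented_gen X rel).
Variable (act : G -> V -> V).
Hypotheses (actB : forall g, {morph act g : u v / u - v}).
Hypotheses (actM : forall g h v, act (g * h)%g v = act g (act h v)).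
Hypotheses (act1 : forall v, act 1%g v = v).
Implicit Types (e : X -> G -> V) (x y : G) (u v : word X).

(* The value of psi (u x) - u psi(x) for any psi such that            *)
(* psi (c x) - c psi(x) = e c x for all generators c.                  *)
Fixpoint integral e u x : V :=
  match u with
  | [::] => 0
  | (c, true) :: u' => e c (cls u' * x)%g + act (gen c) (integral e u' x)
  | (c, false) :: u' =>
      act (gen c)^-1%g (integral e u' x - e c ((gen c)^-1 * (cls u' * x))%g)
  end.

Lemma cls_cons c b u :
  cls ((c, b) :: u) = ((if b then gen c else (gen c)^-1) * cls u)%g.
Proof. by rewrite -cat1s cls_cat; case: b => //; rewrite -cls_winv. Qed.

Lemma cls_nil : cls [::] = 1%g. Proof. by []. Qed.

Lemma integral_cat e u v x :
  integral e (u ++ v) x = integral e u (cls v * x)%g + act (cls u) (integral e v x).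
Proof.
elim: u => [|[c []] u IHu] /=; first by rewrite cls_nil act1 add0r.
  by rewrite IHu cls_cons actM (actD actB) cls_cat !mulgA addrA.
rewrite IHu cls_cons actM -(actD actB); congr (act _ _).
by rewrite cls_cat !mulgA addrAC.
Qed.

Lemma integral_winv e u x :
  integral e (winv u) x
  = - act (cls u)^-1%g (integral e u ((cls u)^-1 * x)%g).
Proof.
elim: u x => [|[c b] u IHu] x; first by rewrite /= (act0 actB) oppr0.
rewrite -cat1s winv_cat integral_cat IHu integral_cat cls_cat !cls_winv invgM.
rewrite (actD actB) opprD -!mulgA mulVKg -[X in _ = _ - X]actM mulgVK addrC.
congr (_ - _); rewrite actM -(actN actB); congr (act _ _).
case: b; rewrite /= !cls_cons !cls_nil !mulg1 ?mul1g ?(act0 actB) ?addr0.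
  by rewrite sub0r (actN actB).
by rewrite invgK sub0r !(actN actB) opprK mulKg -actM mulgV act1.
Qed.

Lemma integral_wcong e u v :
  (forall u v, rel u v -> integral e u =1 integral e v) ->
  wcong rel u v -> integral e u =1 integral e v.
Proof.
move=> erel; elim=> {u v} //.
- by move=> u v _ IHu x; rewrite IHu.
- by move=> u v w _ IHu _ IHv x; rewrite IHu IHv.
- move=> u u' v v' uu' IHu vv' IHv x; rewrite !integral_cat IHu IHv.
  by rewrite (presented_classP rel u u').1 // (presented_classP rel v v').1.
- move=> c [] x /=; rewrite cls_cons cls_nil mulg1 mul1g ?(act0 actB).
    by rewrite sub0r (actKV actM act1) subrr.
  by rewrite addr0 mulKg subrr (act0 actB).
Qed.

Lemma integralB e e' u x :
  integral (fun c y => e c y - e' c y) u x = integral e u x - integral e' u x.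
Proof.
elim: u => [|[c []] u IHu] /=; first by rewrite subrr.
  by rewrite IHu actB !opprD addrACA.
rewrite IHu -actB; congr act; rewrite !opprB addrACA [RHS]addrACA.
by congr (_ + _); rewrite addrC.
Qed.

Lemma eq_integral e e' u x : (forall c y, e c y = e' c y) ->
  integral e u x = integral e' u x.
Proof. by move=> ee'; elim: u => [|[c []] u IHu] //=; rewrite IHu ee'. Qed.

Lemma integral_translate e g u x :
  integral (fun c y => e c (y * g)%g) u x = integral e u (x * g)%g.
Proof. by elim: u => [|[c []] u IHu] //=; rewrite IHu !mulgA. Qed.

Lemma integral_inner_faces (e : X -> G -> seq G -> V) u x g s :
  integral (fun c y => inner_faces (e c y) g s) u x
  = inner_faces (fun t => integral (fun c y => e c y t) u x) g s.
Proof. by elim: s e g => //= h s IHs e g; rewrite integralB IHs. Qed.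

(** The coboundary translates the argument on the right, while integration moves it on the left, so
    the two commute. *)
Lemma integral_cobound_ind (e : X -> G -> seq G -> V) u x g s :
  integral (fun c y => cobound_ind (e c) y (g :: s)) u x
  = cobound_ind (fun y t => integral (fun c z => e c z t) u y) x (g :: s).
Proof.
by rewrite integralB integral_inner_faces (integral_translate (fun c y => e c y s)).
Qed.

Lemma integral_diff psi u x :
  integral (fun c y => psi (gen c * y)%g - act (gen c) (psi y)) u x
  = psi (cls u * x)%g - act (cls u) (psi x).
Proof.
elim: u => [|[c []] u IHu] /=; first by rewrite cls_nil mul1g act1 subrr.
  by rewrite IHu cls_cons actM actB mulgA addrA addrNK.
rewrite IHu cls_cons actM mulVKg opprB addrC addrA addrNK.
by rewrite actB (actVK actM act1) mulgA.
Qed.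

(** Path independence: integrals agree on congruent words, so integrating from 1 to x along any word
    for x defines psi. *)
Lemma potential_ex e :
  (forall u v, rel u v -> integral e u =1 integral e v) ->
  exists psi : G -> V, forall c x, psi (gen c * x)%g - act (gen c) (psi x) = e c x.
Proof.
move=> erel; exists (fun x => integral e (presented_repr x) 1%g) => c x.
rewrite (@integral_wcong _ _ ((c, true) :: presented_repr x) erel).
  by rewrite /= mulg1 presented_reprK addrK.
apply/presented_classP.
by rewrite [LHS]presented_reprK cls_cons [presented_class _ _]presented_reprK.
Qed.

End WordIntegral.

(** * Twist knot groups: cohomology in degrees at least two *)

Section TwistCohomology.
Variables (n : int) (V : zmodType).
Local Notation G := (twist_group n).
Local Notation a := (twist_a n).
Local Notation b := (twist_b n).
Local Notation w := (twist_w n).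
Local Notation wn := (gexpz (twist_w n) n).
Local Notation cls := (presented_class (twist_rel n)).
Local Notation gen := (presented_gen (twist_rel n)).
Variable (act : G -> V -> V).
Hypotheses (actB : forall g, {morph act g : u v / u - v}).
Hypotheses (actM : forall g h v, act (g * h)%g v = act g (act h v)).
Hypotheses (act1 : forall v, act 1%g v = v).
Implicit Types (e : bool -> G -> V) (x y : G) (s : seq G).

(** The obstruction to e being of the form [diff psi]: the difference of its integrals along the two
    sides of the relation. *)
Definition defect e x : V :=
  integral act e (letter true ++ wexp twist_word n) x
  - integral act e (wexp twist_word n ++ letter false) x.

Definition diff (psi : G -> V) (c : bool) x : V :=
  psi (gen c * x)%g - act (gen c) (psi x).

Lemma defect_diff psi x : defect (diff psi) x = 0.
Proof.
rewrite /defect /diff !(integral_diff actB actM act1).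
suff -> : cls (letter true ++ wexp twist_word n)
        = cls (wexp twist_word n ++ letter false) by rewrite subrr.
by apply/presented_classP; apply: wcong_rel.
Qed.

Lemma defect_potential e :
  (forall x, defect e x = 0) -> exists psi, forall c x, diff psi c x = e c x.
Proof.
move=> e0; apply: (potential_ex actB actM act1) => _ _ [-> ->] x.
by apply/subr0_eq/e0.
Qed.

Lemma defectB e e' x : defect (fun c y => e c y - e' c y) x = defect e x - defect e' x.
Proof.
rewrite /defect !(integralB actB) !opprB addrACA [RHS]addrACA.
by congr (_ + _); rewrite addrC.
Qed.

Lemma eq_defect e e' x : (forall c y, e c y = e' c y) -> defect e x = defect e' x.
Proof. by move=> ee'; rewrite /defect !(eq_integral _ _ _ ee'). Qed.

Lemma defect_cobound_ind (e : bool -> G -> seq G -> V) x g s :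
  defect (fun c y => cobound_ind (e c) y (g :: s)) x
  = cobound_ind (fun y t => defect (fun c z => e c z t) y) x (g :: s).
Proof. by rewrite cobound_indB /defect !(integral_cobound_ind actB). Qed.

Lemma cobound_ind_diff (f : G -> seq G -> V) c x s :
  cobound_ind (fun y t => diff (f ^~ t) c y) x s
  = diff (cobound_ind f ^~ s) c x.
Proof.
rewrite cobound_indB (cobound_ind_morph _ _ _ (actB _)) /diff; congr (_ - _).
by case: s => //= g s; rewrite mulgA.
Qed.

Lemma diff_eq0 psi : (forall c x, diff psi c x = 0) ->
  forall x, psi x = act x (psi 1%g).
Proof.
move=> psi0; have psiE c x : psi (gen c * x)%g = act (gen c) (psi x).
  exact/subr0_eq/psi0.
elim/presented_ind => [|c x IHx|c x IHx]; first by rewrite act1.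
  by rewrite psiE IHx actM.
by rewrite actM -IHx -[in RHS](mulVKg (gen c) x) psiE (actVK actM act1).
Qed.

(* Given the correction term, this is the staircase argument in the double *)
(* complex of the resolution                                               *)
(*   0 -> V -> Map(G, V) -> Map(G, V)^2 -> Map(G, V) -> 0                  *)
(* whose maps are [v |-> (x |-> x v)], [diff] and [defect].                *)
Lemma cocycle_cobound i (f : seq G -> V) :
  (forall P : G -> seq G -> V,
     (forall x s, size s = i.+1 -> cobound_ind P x s = 0) ->
     exists2 e : bool -> G -> seq G -> V,
       forall c x s, size s = i.+1 -> cobound_ind (e c) x s = 0 &
       forall x s, size s = i -> defect (fun c y => e c y s) x = P x s) ->
  (forall s, size s = i.+3 -> cobound act f s = 0) ->
  exists g, forall s, size s = i.+2 -> cobound act g s = f s.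
Proof.
(* As f is a cocycle, the coboundary of [e0] is [act x (f s)], which [diff] kills. So [diff] of [e0]
   is closed and is the coboundary of its contraction [e1]. *)
move=> corr fZ; pose e0 x s := f (x :: s); pose e0' c x s := diff (e0 ^~ s) c x.
have e0E x s : size s = i.+2 -> cobound_ind e0 x s = act x (f s).
  case: s => // g s si; have /subr0_eq E := fZ [:: x, g & s] (congr1 S si).
  by rewrite E.
have e0'Z c x s : size s = i.+2 -> cobound_ind (e0' c) x s = 0.
  move=> si; rewrite cobound_ind_diff /diff !e0E // actM subrr //.
pose e1 c := contract (e0' c).
have e1E c x s : size s = i.+1 -> cobound_ind (e1 c) x s = e0' c x s.
  by case: s => // g s [si]; apply: cobound_ind_contract; rewrite e0'Z //= si.
(* The defect of [e1] is again closed. Subtracting the closed correction e makes the defect zero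
   without changing the coboundary of [e1]. *)
pose P x s := defect (fun c y => e1 c y s) x.
have [x s si|e eZ eE] := corr P.
  case: s si => // g s [si].
  rewrite -defect_cobound_ind -[RHS](defect_diff (e0 ^~ (g :: s)) x).
  by apply: eq_defect => c y; rewrite e1E //= si.
have psi_ex s : exists psi, size s = i ->
    forall c x, diff psi c x = e1 c x s - e c x s.
  have [si|] := pselect (size s = i); last by exists (fun _ => 0).
  have [x|psi psiE] := @defect_potential (fun c x => e1 c x s - e c x s).
    by rewrite defectB eE // subrr.
  by exists psi.
pose psi x s := sval (cid (psi_ex s)) x.
have psiE c x s : size s = i -> diff (psi ^~ s) c x = e1 c x s - e c x s.
  by move=> si; rewrite /psi; case: cid => /= ? ->.
(* Subtracting the coboundary of psi makes h vanish under [diff], hence equivariant in x, while its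
   coboundary stays that of [e0]. So its value at x = 1 is a primitive of f. *)
pose h x s := e0 x s - cobound_ind psi x s.
have hE x s : size s = i.+1 -> h x s = act x (h 1%g s).
  move=> si; apply: (@diff_eq0 (h ^~ s)) => c {}x.
  have -> : diff (h ^~ s) c x = e0' c x s - diff (cobound_ind psi ^~ s) c x.
    rewrite /e0' /diff /h actB !opprB addrACA [RHS]addrACA; congr (_ + _).
    by rewrite addrC.
  rewrite -cobound_ind_diff.
  rewrite (@eq_cobound_ind _ _ _ (fun y t => e1 c y t - e c y t) i) //; last first.
    by move=> y t ti; exact: psiE.
  by rewrite cobound_indB e1E // eZ // subr0 subrr.
exists (h 1%g) => -[|g s] // [si] /=.
rewrite -hE //.
have <- : cobound_ind h 1%g (g :: s) = f (g :: s).
  rewrite cobound_indB e0E ?act1; last by rewrite /= si.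
  by case: s si => // k s _; rewrite cobound_indK subr0.
by rewrite /= mul1g.
Qed.

(** With this choice of cochain the four letters of w cancel. Powers of w then contribute nothing,
    and the defect reduces to the two end letters, as in [defect_twist_word0]. *)
Lemma integral_twist_word (eps : G -> V) x :
  (forall y, eps (b^-1 * a * y)%g = act (a * b^-1)%g (eps y)) ->
  integral act (fun c y => if c then eps (b^-1 * a * y)%g else eps y) twist_word x = 0.
Proof.
move=> epsE; rewrite /twist_word /letter /=.
rewrite -![presented_gen _ true]/a -![presented_gen _ false]/b.
rewrite !cls_cons !cls_nil
  -![presented_gen _ true]/a -![presented_gen _ false]/b !mulg1 mul1g.
rewrite (act0 actB) addr0 -!mulgA mulVKg mulKg subrr (act0 actB) sub0r.
by rewrite 2!(actN actB) -actM mulgA epsE subrr.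
Qed.

Lemma integral_wexp0 e u m : (forall x, integral act e u x = 0) ->
  forall x, integral act e (wexp u m) x = 0.
Proof.
move=> u0; have E v : (forall x, integral act e v x = 0) ->
    forall k x, integral act e (flatten (nseq k v)) x = 0.
  move=> v0; elim=> //= k IHk x.
  by rewrite (integral_cat actB actM act1) v0 IHk (act0 actB) addr0.
case: m => k; apply: E => // x.
by rewrite (integral_winv actB actM act1) u0 (act0 actB) oppr0.
Qed.

Lemma defect_twist_word0 e : (forall x, integral act e twist_word x = 0) ->
  forall x, defect e x = e true (wn * x)%g - act wn (e false x).
Proof.
move=> w0 x; rewrite /defect !(integral_cat actB actM act1) !integral_wexp0 //.
rewrite cls_wexp cls_twist_word /= cls_nil !(act0 actB) !addr0 add0r.
by rewrite !mul1g.
Qed.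

(** In the form of [integral_twist_word], the equation prescribes how eps changes under left
    multiplication by v and by w^n. These generate a free group acting freely on G, so eps may be
    chosen at will on coset representatives and then propagated. *)
Lemma defect_surj (phi : G -> V) : n != 0 ->
  exists e, forall x, defect e x = phi x.
Proof.
move=> n0; have [f [fM f1 f0]] := seifert_hom_ex n.
have fI := seifert_hom_inj n0 (And3 fM f1 f0).
pose ab := (a * b^-1)%g; pose v := (b^-1 * a)%g.
pose X (p : G * V) := ((v * p.1)%g, act ab p.2).
pose X' (p : G * V) := ((v^-1 * p.1)%g, act ab^-1%g p.2).
(* [X] and [Z] are the two propagation rules, as permutations of graph points (g, eps g). The second
   is the equation a b^-1 eps(w^n g) = w^n eps(g) + phi(g). *)
pose Z (p : G * V) := ((wn * p.1)%g, act ab^-1%g (act wn p.2 + phi p.1)).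
pose Z' (p : G * V) :=
  ((wn^-1 * p.1)%g, act wn^-1%g (act ab p.2 - phi (wn^-1 * p.1)%g)).
have actK := actVK actM act1; have actK' := actKV actM act1.
have XK : cancel X X' by case=> g m; rewrite /X /X' /= mulKg actK.
have X'K : cancel X' X by case=> g m; rewrite /X /X' /= mulVKg actK'.
have ZK : cancel Z Z' by case=> g m; rewrite /Z /Z' /= mulKg actK' addrK actK.
have Z'K : cancel Z' Z by case=> g m; rewrite /Z /Z' /= mulVKg actK' addrNK actK.
have [T TM TE] := free_lift (fun c => if c then MkSym XK X'K else MkSym ZK Z'K).
have T1 h p : (T h p).1 = (f h * p.1)%g.
  elim/presented_ind: h p => [|c h IHh|c h IHh] p.
  - by rewrite (hom1 TM) (hom1 fM) mul1g.
  - rewrite TM symM fM -mulgA -IHh TE; case: c; rewrite (f1, f0) //.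
  - rewrite TM symM fM -mulgA -IHh (homV TM) (homV fM) TE.
    by case: c; rewrite (f1, f0).
(* Starting from the value 0 on each coset representative. *)
pose eps g := (T (coset_coord fM g) (coset_root f g, 0)).2.
have TrE h g : (f h * g)%g = (T (h * coset_coord fM g)%g (coset_root f g, 0)).1.
  by rewrite T1 fM /= -mulgA coset_coordE.
have epsM c g : eps (f (fgen c) * g)%g = (T (fgen c) (g, eps g)).2.
  rewrite /eps coset_coordM // coset_rootM // TM symM; congr (T _ _).2.
  rewrite [LHS]surjective_pairing; congr (_, _).
  by rewrite T1 /= coset_coordE.
have epsv y : eps (v * y)%g = act ab (eps y) by rewrite -[v]f1 epsM TE.
have epsw y : eps (wn * y)%g = act ab^-1%g (act wn (eps y) + phi y).
  by rewrite -[X in eps (X * y)%g]f0 epsM TE.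
exists (fun c y => if c then eps (v * y)%g else eps y) => x.
rewrite defect_twist_word0; last by move=> y; apply: integral_twist_word.
by rewrite epsv epsw actK' addrAC subrr add0r.
Qed.

(** The correction for [cocycle_cobound] is found by contracting P, solving the defect equation for
    the contraction pointwise, and taking the coboundary of the solution. *)
Lemma cohomology_ge3 i (f : seq G -> V) : n != 0 ->
  (forall s, size s = i.+4 -> cobound act f s = 0) ->
  exists g, forall s, size s = i.+3 -> cobound act g s = f s.
Proof.
move=> n0; apply: cocycle_cobound => P PZ.
have e_ex s : exists e, forall x, defect e x = contract P x s.
  exact: defect_surj.
pose e c x s := sval (cid (e_ex s)) c x.
exists (fun c => cobound_ind (e c)) => [c x [|g [|h s]] // _|x [|g s] // [si]].
  exact: cobound_indK.
rewrite defect_cobound_ind -[RHS]cobound_ind_contract; last by rewrite PZ //= si.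
apply: (@eq_cobound_ind _ _ _ _ i) => [y t _|]; last by rewrite /= si.
by rewrite /e; case: cid.
Qed.

(** In this degree P is a closed 0-cochain, hence constant in x, so only constant defects have to be
    realised. *)
Lemma cohomology2 (f : seq G -> V) :
  (forall m : V, exists k : bool -> V, forall x, defect (fun c _ => k c) x = m) ->
  (forall s, size s = 3 -> cobound act f s = 0) ->
  exists g, forall s, size s = 2 -> cobound act g s = f s.
Proof.
move=> surj; apply: cocycle_cobound => P PZ.
have [k kE] := surj (P 1%g [::]).
exists (fun c _ _ => k c) => [c x [|g [|]] //= _|x [|//] _]; first by rewrite subrr.
by rewrite kE; have /subr0_eq := PZ 1%g [:: x] erefl; rewrite mul1g => ->.
Qed.

End TwistCohomology.

(** * Duality between the bar complex and its cohomology *)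

Section Separation.
Import classical_sets.
Variables (F : fieldType) (E : lmodType F).

Definition subspace (A : E -> Prop) := A 0 /\ forall k u v, A u -> A v -> A (k *: u + v).

(** A maximal subspace containing U and avoiding c is a hyperplane complementary to the line of c; L
    is the coordinate along c. *)
Lemma separating_functional (U : E -> Prop) (c : E) : subspace U -> ~ U c ->
  exists L : E -> F, [/\ forall k u v, L (k *: u + v) = k * L u + L v,
    forall u, U u -> L u = 0 & L c = 1].
Proof.
move=> [U0 UD] Uc.
pose P (A : set E) := [/\ forall u, U u -> A u, subspace A & ~ A c].
have [|A [PA Amax]] := @Zorn_bigcup E (fun A => A = set0 \/ P A).
  move=> FF FP FT; have [FF0|] := pselect (forall X, FF X -> X = set0).
    by left; apply/seteqP; split=> // x [X /FF0 ->].
  move=> /existsNP[X0 /not_implyP[FX0 X0n]]; right.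
  have [//|[UX0 [_ _] _]] := FP _ FX0.
  split; first by move=> u /UX0; exists X0.
    split; first by exists X0 => //; exact: UX0.
    move=> k u v [X FX Xu] [Y FY Yv].
    have [XY|YX] := FT _ _ FX FY.
      exists Y => //; have [Y0|[_ [_ YD] _]] := FP _ FY; last exact: YD (XY _ Xu) Yv.
      by move: Yv; rewrite Y0.
    exists X => //; have [X_0|[_ [_ XD] _]] := FP _ FX; last exact: XD Xu (YX _ Yv).
    by move: Xu; rewrite X_0.
  by move=> [X FX Xc]; have [X_0|[_ _ /(_ Xc)//]] := FP _ FX; move: Xc; rewrite X_0.
have {PA} [UA [A0 AD] Ac] : P A.
  case: PA => // A_0; have [] := Amax U; last by right; split.
  by rewrite A_0; split=> // /(_ 0 U0).
have AZ k u : A u -> A (k *: u) by move=> Au; rewrite -[_ *: _]addr0; exact: AD.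
have coord_ex x : exists k, A (x - k *: c).
  have [Ax|Ax] := pselect (A x); first by exists 0; rewrite scale0r subr0.
  (* B is A enlarged by the line of x. By maximality it contains c, which gives x a coordinate along
     c. *)
  pose B : set E := fun y => exists k, A (y - k *: x).
  have AB : (A `<` B)%classic.
    split; first by move=> y Ay; exists 0; rewrite scale0r subr0.
    move=> /(_ x); apply: contra_not Ax => /(_ _)/=; apply.
    by exists 1; rewrite scale1r subrr.
  have BD : subspace B.
    split; first by exists 0; rewrite scale0r subr0.
    move=> k u v [p Ap] [q Aq]; exists (k * p + q).
    rewrite scalerDl opprD addrACA -scalerA -scalerBr; exact: AD.
  have [k Ak] : B c.
    apply: contrapT => Bc; apply: (Amax B AB); right; split=> //.
    by move=> u /UA/(proj1 AB).
  have k0 : k != 0 by apply/eqP=> k0; move: Ak; rewrite k0 scale0r subr0.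
  exists k^-1; have := AZ (- k^-1) _ Ak.
  by rewrite scaleNr scalerBr scalerA mulVf // scale1r opprB.
pose L x := sval (cid (coord_ex x)).
have LA x : A (x - L x *: c) by rewrite /L; case: cid.
have Luniq x k : A (x - k *: c) -> L x = k.
  move=> Ak; apply/eqP; rewrite -subr_eq0; apply/negPn/negP => d0.
  apply: Ac; have := AD (-1) _ _ (LA x) Ak.
  rewrite scaleN1r opprB addrA addrNK -scalerBl => /(AZ (L x - k)^-1).
  by rewrite scalerA mulVf // scale1r.
exists L; split=> [k u v|u Uu|].
- apply: Luniq; rewrite scalerDl opprD addrACA -scalerA -scalerBr.
  by apply: AD; exact: LA.
- by apply: Luniq; rewrite scale0r subr0; exact: UA.
- by apply: Luniq; rewrite scale1r subrr.
Qed.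

End Separation.

Section MalgSum.
Variables (K : choiceType) (V E : zmodType) (B : V -> K -> E).
Hypothesis BD : forall t, {morph B ^~ t : u v / u + v}.

Definition malg_sum (c : {malg V[K]}) : E := \sum_(t <- msupp c) B c@_t t.

Lemma malg_sum_B0 t : B 0 t = 0.
Proof. by apply: (addrI (B 0 t)); rewrite -BD !addr0. Qed.

Lemma malg_sumEw (d : {fset K}) c : (msupp c `<=` d)%fset ->
  malg_sum c = \sum_(t <- d) B c@_t t.
Proof.
move=> le; rewrite [LHS](big_fset_incl _ le) => //= x xd /mcoeff_outdom ->.
by rewrite malg_sum_B0.
Qed.

Lemma malg_sumD : {morph malg_sum : c d / c + d}.
Proof.
move=> c d; pose D := (msupp c `|` msupp d)%fset.
rewrite (malg_sumEw (d := D)) ?msuppD_le //.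
rewrite (malg_sumEw (d := D) (c := c)) ?fsubsetUl //.
rewrite (malg_sumEw (d := D) (c := d)) ?fsubsetUr // -big_split.
by apply: eq_bigr => t _ /=; rewrite mcoeffD BD.
Qed.

Lemma malg_sumU v t : malg_sum << v *g t >> = B v t.
Proof. by rewrite (malg_sumEw msuppU_le) big_seq_fset1 mcoeffUU. Qed.

Lemma malg_sum0 : malg_sum 0 = 0.
Proof. by apply: (addrI (malg_sum 0)); rewrite -malg_sumD !addr0. Qed.

End MalgSum.

Section MalgScale.
Variables (F : fieldType) (K : choiceType) (V : lmodType F).

(** An alias of the chain group that carries the coefficientwise vector space structure, needed to
    separate by functionals. *)
Definition vmalg := {malg V[K]}.
HB.instance Definition _ := GRing.Zmodule.on vmalg.

Definition vmalg_scale (k : F) (c : vmalg) : vmalg :=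
  malg_sum (fun v t => << k *: v *g t >>) c.

Lemma vmalg_scaleE k (c : vmalg) t : (vmalg_scale k c)@_t = k *: c@_t.
Proof.
have -> : c@_t = \sum_(s <- msupp c) << c@_s *g s >>@_t.
  by rewrite {1}[c]monalgE raddf_sum.
rewrite raddf_sum scaler_sumr.
by apply: eq_bigr => s _; rewrite -[LHS]/(_@_t) !mcoeffU scalerMnr.
Qed.

Fact vmalg_scaleA k l c : vmalg_scale k (vmalg_scale l c) = vmalg_scale (k * l) c.
Proof. by apply/malgP=> t; rewrite !vmalg_scaleE scalerA. Qed.
Fact vmalg_scale1 c : vmalg_scale 1 c = c.
Proof. by apply/malgP=> t; rewrite vmalg_scaleE scale1r. Qed.
Fact vmalg_scaleDr k : {morph vmalg_scale k : c d / c + d}.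
Proof.
move=> c d; apply/malgP=> t.
by rewrite mcoeffD !vmalg_scaleE -scalerDr -mcoeffD.
Qed.
Fact vmalg_scaleDl c : {morph vmalg_scale ^~ c : k l / k + l}.
Proof. by move=> k l; apply/malgP=> t; rewrite mcoeffD !vmalg_scaleE scalerDl. Qed.

HB.instance Definition _ := GRing.Zmodule_isLmodule.Build F vmalg
  vmalg_scaleA vmalg_scale1 vmalg_scaleDr vmalg_scaleDl.

Lemma vmalgZE k (c : vmalg) t : (k *: c)@_t = k *: c@_t.
Proof. exact: vmalg_scaleE. Qed.

Lemma malg_sumZ (E : lmodType F) (B : V -> K -> E) :
  (forall t, {morph B ^~ t : u v / u + v}) ->
  (forall k v t, B (k *: v) t = k *: B v t) ->
  forall k (c : vmalg), malg_sum B (k *: c) = k *: malg_sum B c.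
Proof.
move=> BD BZ k c; rewrite (malg_sumEw BD (d := msupp c)).
  by rewrite /malg_sum scaler_sumr; apply: eq_bigr => t _; rewrite vmalgZE BZ.
apply/fsubsetP=> t; rewrite -!mcoeff_neq0 vmalgZE.
by apply: contraNN => /eqP ->; rewrite scaler0.
Qed.

End MalgScale.

Section Faces.
Variables (G : groupType).

(** [face_succ] on underlying sequences; merging at the last entry drops it. *)
Fixpoint merge_at (j : nat) (s : seq G) : seq G :=
  match j, s with
  | _, [::] => [::]
  | 0, [:: g] => [::]
  | 0, [:: g, h & s'] => (g * h)%g :: s'
  | j'.+1, g :: s' => g :: merge_at j' s'
  end.

Lemma nth_merge_at j s k : (j < size s)%N -> (k < (size s).-1)%N ->
  nth 1%g (merge_at j s) k =
    if (k < j)%N then nth 1%g s k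
    else if k == j then (nth 1%g s k * nth 1%g s k.+1)%g else nth 1%g s k.+1.
Proof.
elim: s j k => // g [|h s] IHs [|j] k //=.
  by case: k.
move=> jk ks; case: k ks => // k ks; rewrite [LHS]/= IHs //.
Qed.

Lemma size_merge_at j s : (j < size s)%N -> size (merge_at j s) = (size s).-1.
Proof. by elim: s j => // g [|h s] IHs [|j] //= js; rewrite IHs. Qed.

Lemma face_first_seq i (t : i.+1.-tuple G) : face_first t = behead t :> seq G.
Proof.
apply: (@eq_from_nth _ 1%g); rewrite size_tuple ?size_behead ?size_tuple // => k ki.
rewrite -(tnth_nth 1%g _ (Ordinal ki)) tnth_mktuple (tnth_nth 1%g) nth_behead.
by rewrite lift0.
Qed.

Lemma face_succ_seq i (j : 'I_i.+1) (t : i.+1.-tuple G) :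
  face_succ j t = merge_at j t :> seq G.
Proof.
apply: (@eq_from_nth _ 1%g); rewrite size_tuple ?size_merge_at ?size_tuple // => k ki.
rewrite -(tnth_nth 1%g _ (Ordinal ki)) tnth_mktuple !(tnth_nth 1%g) lift0 /=.
by rewrite nth_merge_at ?size_tuple.
Qed.

Lemma inner_faces_sum (R : pzRingType) (V : lmodType R) (f : seq G -> V) g s :
  inner_faces f g s = \sum_(j < (size s).+1) (-1) ^+ j *: f (merge_at j (g :: s)).
Proof.
elim: s f g => [|h s IHs] f g; first by rewrite big_ord_recl big_ord0 addr0 scale1r.
rewrite big_ord_recl scale1r [LHS]/= IHs -sumrN; congr (_ + _).
by apply: eq_bigr => j _; rewrite -scaleNr lift0 exprS mulN1r.
Qed.

End Faces.

Lemma singular_kernel (F : fieldType) k (M : 'M[F]_k) :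
  M \notin unitmx -> exists2 v : 'cV[F]_k, v != 0 & M *m v = 0.
Proof.
rewrite -unitmx_tr -row_free_unit -kermx_eq0 => /rowV0Pn[v /sub_kermxP vE v0].
exists v^T; first by rewrite -(inj_eq (@trmx_inj _ _ _)) trmxK trmx0.
by rewrite -[M]trmxK -trmx_mul vE trmx0.
Qed.

(** * The symplectic pairing of cochains with chains *)

Section Pairing.
Variable F : fieldType.
Implicit Types (u v : 'cV[F]_2) (A : SL2 F).

(* The invariant symplectic form, which identifies F^2 with its dual. *)
Definition pairing u v : F := u 0 0 * v 1 0 - u 1 0 * v 0 0.

Lemma pairingDl u u' v : pairing (u + u') v = pairing u v + pairing u' v.
Proof. by rewrite /pairing !mxE; ring. Qed.

Lemma pairingZl k u v : pairing (k *: u) v = k * pairing u v.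
Proof. by rewrite /pairing !mxE; ring. Qed.

Lemma pairingDr u v v' : pairing u (v + v') = pairing u v + pairing u v'.
Proof. by rewrite /pairing !mxE; ring. Qed.

Lemma pairingZr k u v : pairing u (k *: v) = k * pairing u v.
Proof. by rewrite /pairing !mxE; ring. Qed.

Lemma pairing0l v : pairing 0 v = 0.
Proof. by rewrite /pairing !mxE !mul0r subrr. Qed.

Lemma pairingNl u v : pairing (- u) v = - pairing u v.
Proof. by rewrite -scaleN1r pairingZl mulN1r. Qed.

Lemma pairing_suml I (r : seq I) (P : pred I) (f : I -> 'cV[F]_2) v :
  pairing (\sum_(i <- r | P i) f i) v = \sum_(i <- r | P i) pairing (f i) v.
Proof. by elim/big_rec2: _ => [|i x u _ <-]; rewrite ?pairing0l ?pairingDl. Qed.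

Lemma det2 (A : 'M[F]_2) : \det A = A 0 0 * A 1 1 - A 0 1 * A 1 0.
Proof.
rewrite (expand_det_row _ 0) !big_ord_recl big_ord0 addr0 /cofactor !det_mx11 !mxE /=.
rewrite expr0 expr1 mul1r mulN1r mulrN.
by congr (A _ _ * A _ _ - A _ _ * A _ _); apply: val_inj.
Qed.

Lemma mulmx2E m (A : 'M[F]_2) (B : 'M[F]_(2, m)) i j :
  (A *m B) i j = A i 0 * B 0 j + A i 1 * B 1 j.
Proof.
rewrite mxE !big_ord_recl big_ord0 addr0.
by congr (_ + A _ _ * B _ _); apply: val_inj.
Qed.

Lemma pairing_mulmx A u v : pairing (A *m u) (A *m v) = pairing u v.
Proof.
have dA : A 0 0 * A 1 1 - A 0 1 * A 1 0 = 1 by rewrite -det2 SL2_det.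
rewrite /pairing !mulmx2E -[RHS]mul1r -dA; ring.
Qed.

Lemma pairing_inj u u' : (forall v, pairing u v = pairing u' v) -> u = u'.
Proof.
move=> E; have := E (delta_mx 0 0); have := E (delta_mx 1 0).
rewrite /pairing !mxE /= !(mulr1, mulr0, subr0, sub0r) => E0 /oppr_inj E1.
apply/matrixP => -[[|[|//]] jp] k; rewrite ord1.
  by rewrite (_ : Ordinal jp = 0) //; apply: val_inj.
by rewrite (_ : Ordinal jp = 1) //; apply: val_inj.
Qed.

Lemma functional_pairing (L : 'cV[F]_2 -> F) :
  (forall k u v, L (k *: u + v) = k * L u + L v) ->
  exists u, forall v, L v = pairing u v.
Proof.
move=> LD; have L0 : L 0 = 0.
  by apply: (addrI (L 0)); have := LD 1 0 0; rewrite scaler0 !addr0 mul1r => <-.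
have LZ k u : L (k *: u) = k * L u by rewrite -[_ *: _]addr0 LD L0 addr0.
exists (\col_i if i == 0 then L (delta_mx 1 0) else - L (delta_mx 0 0)) => v.
have {1}-> : v = v 0 0 *: delta_mx 0 0 + v 1 0 *: delta_mx 1 0.
  apply/matrixP=> i j; rewrite !mxE ord1 eqxx.
  case: i => [[|[|//]] ip]; rewrite !(mulr1, mulr0, addr0, add0r);
    by congr (v _ _); apply: val_inj.
by rewrite LD LZ /pairing !mxE /=; ring.
Qed.

End Pairing.

Section Action.
Variables (F : fieldType) (G : groupType) (rho : {multiplicative G -> SL2 F}).
Local Notation V := 'cV[F]_2.

Definition rep_act (g : G) (v : V) : V := (rho g : 'M_2) *m v.
Local Notation act := rep_act.

Lemma rep_hom : is_hom rho. Proof. exact: gmulfM. Qed.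

Lemma rep1 : (rho 1%g : 'M_2) = 1%:M.
Proof. by rewrite (hom1 rep_hom). Qed.

Lemma repM g h : (rho (g * h)%g : 'M_2) = (rho g : 'M_2) *m (rho h : 'M_2).
Proof. by rewrite rep_hom. Qed.

Lemma rep_actB g : {morph act g : u v / u - v}.
Proof. by move=> u v; exact: mulmxBr. Qed.

Lemma rep_actM g h v : act (g * h)%g v = act g (act h v).
Proof. by rewrite /act repM mulmxA. Qed.

Lemma rep_act1 v : act 1%g v = v.
Proof. by rewrite /act rep1 mul1mx. Qed.

Lemma pairing_actV g u v : pairing u (act g^-1%g v) = pairing (act g u) v.
Proof.
rewrite -(pairing_mulmx (rho g)); congr (pairing _ _).
exact: (actKV rep_actM rep_act1).
Qed.

Lemma vmalgZU (K : choiceType) k (v : V) (t : K) :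
  << k *: v *g t >> = k *: (<< v *g t >> : vmalg K V).
Proof. by apply/malgP=> s; rewrite vmalgZE !mcoeffU scalerMnr. Qed.

Lemma boundary_termD i t : {morph boundary_term (i := i) rho ^~ t : u v / u + v}.
Proof.
move=> u v; rewrite /boundary_term mulmxDr monalgUD addrACA -big_split /=.
by congr (_ + _); apply: eq_bigr => j _; rewrite scalerDr monalgUD.
Qed.

Lemma boundary_termZ i k u t :
  boundary_term (i := i) rho (k *: u) t
  = k *: (boundary_term rho u t : vmalg (i.-tuple G) V).
Proof.
rewrite /boundary_term scalerDr scaler_sumr -scalemxAr vmalgZU.
congr (_ + _); apply: eq_bigr => j _.
by rewrite -vmalgZU !scalerA mulrC.
Qed.

Lemma boundaryE i (c : chain F G i.+1) :
  boundary rho c = malg_sum (@boundary_term F G rho i) c.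
Proof. by []. Qed.

Lemma boundaryD i : {morph @boundary F G rho i : c d / c + d}.
Proof. by move=> c d; rewrite !boundaryE malg_sumD // => t; exact: boundary_termD. Qed.

Lemma boundaryZ i k (c : vmalg (i.+1.-tuple G) V) :
  boundary rho (k *: c) = k *: (boundary rho c : vmalg (i.-tuple G) V).
Proof.
exact: (malg_sumZ (E := vmalg (i.-tuple G) V) (@boundary_termD i)
  (fun k v t => @boundary_termZ i k v t)).
Qed.

Definition evaluate (f : seq G -> V) i (c : chain F G i) : F :=
  malg_sum (fun v (t : i.-tuple G) => pairing (f t) v) c.

Lemma pairing_addr (f : seq G -> V) i (t : i.-tuple G) :
  {morph (fun v => pairing (f t) v) : u v / u + v}.
Proof. by move=> u v; exact: pairingDr. Qed.

Lemma evaluateD f i : {morph @evaluate f i : c d / c + d}.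
Proof. exact: malg_sumD (@pairing_addr f i). Qed.

Lemma evaluateU f i v t : @evaluate f i << v *g t >> = pairing (f t) v.
Proof. exact: malg_sumU (@pairing_addr f i) v t. Qed.

Lemma evaluate0 f i : @evaluate f i 0 = 0.
Proof. exact: malg_sum0 (@pairing_addr f i). Qed.

Lemma evaluateZ f i k (c : vmalg (i.-tuple G) V) :
  evaluate f (k *: c) = k * evaluate f c.
Proof.
apply: (malg_sumZ (E := F^o) (@pairing_addr f i)) => l v t.
exact: pairingZr.
Qed.

Lemma evaluate_sum f i I (r : seq I) (c : I -> chain F G i) :
  evaluate f (\sum_(j <- r) c j) = \sum_(j <- r) evaluate f (c j).
Proof. by elim/big_rec2: _ => [|j x y _ <-]; rewrite ?evaluate0 ?evaluateD. Qed.

(** The boundary and the coboundary are adjoint. The inverse in the first face matches the fact that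
    the adjoint of g for the invariant form is g^-1. *)
Lemma evaluate_boundary f i (c : chain F G i.+1) :
  evaluate f (boundary rho c) = evaluate (cobound act f) c.
Proof.
rewrite /boundary evaluate_sum; apply: eq_bigr => t _; set v := c@_t.
rewrite evaluateD evaluateU evaluate_sum face_first_seq.
case/tupleP: t @v => g t v.
rewrite [thead _]/= -/(act _ _) pairing_actV.
under eq_bigr do rewrite evaluateU face_succ_seq pairingZr -pairingZl.
rewrite -pairing_suml -pairingDl /cobound /=; congr (pairing (_ + _) _).
rewrite (@inner_faces_sum _ F) size_tuple -sumrN.
by apply: eq_bigr => j _; rewrite exprS mulN1r scaleNr.
Qed.

(** A cycle that is not a boundary is detected by a functional vanishing on boundaries. The form
    turns this functional into a cocycle, which is a coboundary (or zero in degree 0) and so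
    vanishes on cycles. *)
Lemma acyclic_cohomology :
  (forall p, (forall g, act g p = p) -> p = 0) ->
  (forall i f, (forall s, size s = i.+2 -> cobound act f s = 0) ->
     exists g, forall s, size s = i.+1 -> cobound act g s = f s) ->
  acyclic rho.
Proof.
move=> H0 Hi i c cZ; apply: contrapT => cB.
have [|L [LD LB Lc]] := @separating_functional F (vmalg (i.-tuple G) V)
    (@is_boundary F G rho i) c _ cB.
  split; first by exists 0; rewrite boundaryE malg_sum0 //; exact: boundary_termD.
  move=> k _ _ [d <-] [e <-]; exists (k *: (d : vmalg _ _) + e).
  by rewrite boundaryD boundaryZ.
have L0 : L 0 = 0.
  by apply: (addrI (L 0)); have := LD 1 0 0; rewrite scaler0 !addr0 mul1r => <-.
have LZ k x : L (k *: x) = k * L x by rewrite -[_ *: _]addr0 LD L0 addr0.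
have LAdd x y : L (x + y) = L x + L y by rewrite -{1}[x]scale1r LD mul1r.
have [phi phiE] : exists phi : i.-tuple G -> V,
    forall t v, L << v *g t >> = pairing (phi t) v.
  suff /choice[phi phiE] : forall t, exists u, forall v, L << v *g t >> = pairing u v.
    by exists phi.
  move=> t; apply: functional_pairing => k u v.
  by rewrite monalgUD vmalgZU LD.
pose f s := if insub s is Some t then phi t else 0.
have fE (t : i.-tuple G) : f t = phi t by rewrite /f valK.
have evL (d : chain F G i) : evaluate f d = L d.
  rewrite [d in RHS]monalgE /evaluate /malg_sum.
  by elim/big_rec2: _ => [|t x y _ ->]; rewrite ?L0 // LAdd phiE fE.
have fZ s : size s = i.+1 -> cobound act f s = 0.
  move=> si; have [t <-] : exists t : i.+1.-tuple G, t = s :> seq G.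
    by exists (Tuple (introT eqP si)).
  apply: pairing_inj => v; rewrite pairing0l.
  by rewrite -evaluateU -evaluate_boundary evL LB //; exists << v *g t >>.
have : evaluate f c = 0; last by rewrite evL Lc => /eqP; rewrite oner_eq0.
case: i c cZ cB L LD LB Lc L0 LZ LAdd phi phiE f fE evL fZ
  => [|i] c cZ cB L LD LB Lc L0 LZ LAdd phi phiE f fE evL fZ.
  have f0 : f [::] = 0.
    by apply: H0 => g; have /subr0_eq := fZ [:: g] erefl.
  rewrite /evaluate /malg_sum big1 // => t _.
  by rewrite tuple0 f0 pairing0l.
have [g gE] := Hi i f fZ.
have -> : evaluate f c = evaluate (cobound act g) c.
  by apply: eq_bigr => t _; rewrite gE // size_tuple.
by rewrite -evaluate_boundary cZ evaluate0.
Qed.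

(** As H_0 = 0, each v is the boundary of some 1-chain; as H_1 = 0, the value of d on that chain
    depends on v only. This linear form in v is represented by p, and testing on the boundary of v
    (x) [g] gives d g. *)
Lemma acyclic_derivation : acyclic rho -> forall d : G -> V,
  (forall g h, d (g * h)%g = d g + act g (d h)) ->
  exists p, forall g, d g = act g p - p.
Proof.
move=> rhoA d dM; pose f (s : seq G) := d (head 1%g s).
have fZ s : size s = 2 -> cobound act f s = 0.
  case: s => [|g [|h []]] //= _; rewrite /f /= dM.
  by rewrite addrAC subrr add0r subrr.
have evB (c : chain F G 2) : evaluate f (boundary rho c) = 0.
  rewrite evaluate_boundary /evaluate /malg_sum big1 // => t _.
  by rewrite fZ ?size_tuple // pairing0l.
have prim_ex v : exists c : chain F G 1, boundary rho c = << v *g [tuple] >>.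
  exact: rhoA 0 _ I.
pose prim v := sval (cid (prim_ex v)).
have primE v : boundary rho (prim v) = << v *g [tuple] >>.
  by rewrite /prim; case: cid.
have boundaryN i (c : chain F G i.+1) : boundary rho (- c) = - boundary rho c.
  apply: (addrI (boundary rho c)); rewrite -boundaryD !subrr boundaryE malg_sum0 //.
  exact: boundary_termD.
have evN i (c : chain F G i) : evaluate f (- c) = - evaluate f c.
  by apply: (addrI (evaluate f c)); rewrite -evaluateD !subrr evaluate0.
have primP v (c : chain F G 1) : boundary rho c = << v *g [tuple] >> ->
    evaluate f c = evaluate f (prim v).
  move=> cv; apply/eqP; rewrite -subr_eq0 -evN -evaluateD.
  have [|e <-] := rhoA 1 (c - prim v); last by rewrite evB.
  by rewrite /= boundaryD boundaryN cv primE subrr.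
have [p pE] : exists p, forall v, evaluate f (prim v) = pairing p v.
  apply: functional_pairing => k u v; rewrite -evaluateZ -evaluateD.
  apply/esym/primP; rewrite boundaryD (boundaryZ k (prim u : vmalg _ _)) (primE u) (primE v).
  by rewrite monalgUD vmalgZU.
exists p => g.
apply: pairing_inj => v.
rewrite pairingDl pairingNl -pairing_actV -[- _]mulN1r -pairingZr scaleN1r -pairingDr.
rewrite -pE -(primP _ << v *g [tuple g] >>) ?evaluateU //.
rewrite boundaryE malg_sumU; last exact: boundary_termD.
rewrite /boundary_term big_ord_recl big_ord0 addr0 expr1 scaleN1r.
rewrite [face_first _]tuple0 [face_succ _ _]tuple0.
by rewrite monalgUB monalgUN.
Qed.

End Action.

(** * The first cohomology of a representation *)

Section Derivations.
Variables (G : groupType) (V : zmodType) (act : G -> V -> V) (d : G -> V).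
Hypotheses (actB : forall g, {morph act g : u v / u - v}).
Hypotheses (actM : forall g h v, act (g * h)%g v = act g (act h v)).
Hypotheses (act1 : forall v, act 1%g v = v).
Hypothesis dM : forall g h, d (g * h)%g = d g + act g (d h).

Lemma deriv1 : d 1%g = 0.
Proof. by apply: (addrI (d 1%g)); have := dM 1 1; rewrite mulg1 act1 addr0. Qed.

Lemma derivV g : d g^-1%g = - act g^-1%g (d g).
Proof.
apply/eqP; rewrite -subr_eq0 opprK; apply/eqP.
by rewrite -dM mulVg deriv1.
Qed.

Lemma deriv_gexpz0 g m : d g = 0 -> d (gexpz g m) = 0.
Proof.
move=> g0; have gX k : d (g ^+ k)%g = 0.
  by elim: k => [|k IHk]; rewrite ?deriv1 // expgS dM g0 IHk (act0 actB) addr0.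
by case: m => k //=; rewrite derivV gX (act0 actB) oppr0.
Qed.

(** Both sides expand d on the identity b a^-1 w = a^-1 b. *)
Lemma deriv_wcomm a b :
  act (b * a^-1)%g (d (wcomm a b))
  = (act a^-1%g (d b) - d b) + (act b (act a^-1%g (d a)) - act a^-1%g (d a)).
Proof.
have : d (b * a^-1 * wcomm a b)%g = d (a^-1 * b)%g.
  by rewrite /wcomm !mulgA mulgVK mulgV mul1g.
rewrite (dM (b * a^-1)) (dM b) (dM a^-1) derivV => E.
apply: (addrI (d b + act b (- act a^-1%g (d a)))); rewrite E (actN actB).
set z := act a^-1%g (d a); rewrite addrA [d b - _ + _]addrC.
by rewrite [_ - d b + _]addrA addrNK addrA addrNK addrC.
Qed.

End Derivations.

(** * Acyclicity and the Fox matrix *)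

Section TwistRepresentations.
Variables (F : fieldType) (n : int).
Local Notation G := (twist_group n).
Variable (rho : {multiplicative twist_group n -> SL2 F}).
Local Notation V := 'cV[F]_2.
Local Notation a := (twist_a n).
Local Notation b := (twist_b n).
Local Notation w := (twist_w n).
Local Notation wn := (gexpz (twist_w n) n).
Local Notation act := (rep_act rho).

Let actB := rep_actB rho.
Let actM := rep_actM rho.
Let act1 := rep_act1 rho.

(** If d kills w, the relation gives d a = w^n (d b), and [deriv_wcomm] then says that this matrix
    kills d b. *)
Definition fox_mx : 'M[F]_2 :=
  ((rho a^-1%g : 'M_2) - 1%:M)
  + ((rho b : 'M_2) - 1%:M) *m (rho a^-1%g : 'M_2) *m (rho wn : 'M_2).

Lemma fox_mxE p : fox_mx *m p
  = (act a^-1%g p - p) + (act b (act a^-1%g (act wn p)) - act a^-1%g (act wn p)).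
Proof. by rewrite /fox_mx mulmxDl -!mulmxA !mulmxBl !mul1mx. Qed.

Lemma derivation_principal (d : G -> V) :
  ((rho w : 'M_2) - 1%:M) \in unitmx -> fox_mx \in unitmx ->
  (forall g h, d (g * h)%g = d g + act g (d h)) ->
  exists p, forall g, d g = act g p - p.
Proof.
move=> Wu Eu dM; pose p := invmx ((rho w : 'M_2) - 1%:M) *m d w.
pose d' g := d g - (act g p - p).
have d'M g h : d' (g * h)%g = d' g + act g (d' h).
  rewrite /d' dM actM !actB [RHS]addrACA -opprD; congr (_ - _).
  by rewrite [RHS]addrC addrA addrNK.
have act0' g : act g 0 = 0 by exact: act0 actB g.
have d'w : d' w = 0.
  have := mulKVmx Wu (d w); rewrite -/p mulmxBl mul1mx => E.
  by rewrite /d' -E subrr.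
have d'wn : d' wn = 0 by exact: (deriv_gexpz0 actB act1 d'M).
have d'a : d' a = act wn (d' b).
  have := congr1 d' (twist_relE n); rewrite !d'M d'wn act0' addr0 add0r //.
have d'b : d' b = 0.
  have := deriv_wcomm actB act1 d'M a b.
  rewrite -/(twist_w n) d'w act0' d'a -fox_mxE => /esym E.
  by rewrite -(mulKmx Eu (d' b)) E mulmx0.
exists p => g; apply/eqP; rewrite -subr_eq0; apply/eqP; rewrite -/(d' g).
have d'1 : d' 1%g = 0 by exact: (deriv1 act1 d'M).
have d'aV : d' a = 0 by rewrite d'a d'b act0'.
elim/twist_ind: g => // g IHg; rewrite d'M IHg act0' addr0 //.
  by rewrite (derivV act1 d'M) d'aV act0' oppr0.
by rewrite (derivV act1 d'M) d'b act0' oppr0.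
Qed.

Lemma integral_const_twist_word (k : bool -> V) x :
  act (b * a^-1)%g (integral act (fun c _ => k c) twist_word x)
  = (act a^-1%g (k false) - k false)
    + (act b (act a^-1%g (k true)) - act a^-1%g (k true)).
Proof.
have act0' g : act g 0 = 0 by exact: act0 actB g.
rewrite /twist_word /letter /= -![presented_gen _ true]/a -![presented_gen _ false]/b.
rewrite act0' addr0 actM (actD actB a^-1) (actD actB b) (actVK actM act1) (actKV actM act1).
by rewrite actB [X in _ + X]addrAC addrCA.
Qed.

Lemma defect_const_surj :
  fox_mx \in unitmx -> forall m : V,
  exists k : bool -> V, forall x, defect act (fun c _ => k c) x = m.
Proof.
(* y is chosen so that the constant cochain integrates to zero along w; its defect is then the value
   at a minus w^n y, that is m. *)
move=> Eu m; pose y := invmx fox_mx *m (act a^-1%g m - act b (act a^-1%g m)).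
exists (fun c => if c then act wn y + m else y) => x.
rewrite (defect_twist_word0 actB actM act1) => [|{}x]; first by rewrite addrC addKr.
apply: (can_inj (actVK actM act1 (b * a^-1)%g)).
rewrite integral_const_twist_word (act0 actB).
rewrite !(actD actB) opprD [X in _ + X]addrACA [LHS]addrA -fox_mxE mulKVmx //.
by rewrite addrA addrNK subrr.
Qed.

Lemma twist_acyclic : n != 0 ->
  (forall p, (forall g, act g p = p) -> p = 0) ->
  ((rho w : 'M_2) - 1%:M) \in unitmx -> fox_mx \in unitmx -> acyclic rho.
Proof.
move=> n0 H0 Wu Eu; apply: acyclic_cohomology => // -[|[|i]] f fZ.
- have [|p pE] := @derivation_principal (fun g => f [:: g]) Wu Eu.
    move=> g h; have /= /subr0_eq -> := fZ [:: g; h] erefl.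
    by rewrite addrC addrNK.
  by exists (fun _ => p) => -[|g []] //= _; rewrite pE.
- exact: (cohomology2 actB actM act1 (defect_const_surj Eu)).
- exact: (cohomology_ge3 actB actM act1).
Qed.

(** A kernel vector p yields a derivation with d b = p, d a = w^n p and d w = 0. If it were
    principal, given by q, then w would fix q, so q = 0 and p = 0. *)
Lemma twist_not_acyclic :
  ((rho w : 'M_2) - 1%:M) \in unitmx -> fox_mx \notin unitmx -> ~ acyclic rho.
Proof.
move=> Wu Eu rhoA.
have [p p0 Ep] := singular_kernel Eu.
pose k c := if c then act wn p else p.
have [|psi psiE] := @defect_potential n V act actB actM act1 (fun c _ => k c).
  move=> x; rewrite (defect_twist_word0 actB actM act1); first by rewrite subrr.
  move=> {}x; apply: (can_inj (actVK actM act1 (b * a^-1)%g)).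
  by rewrite integral_const_twist_word -fox_mxE Ep -/(act _ _) (act0 actB).
pose d g := psi g - act g (psi 1%g).
have psiM c x : psi (presented_gen _ c * x)%g = act (presented_gen _ c) (psi x) + k c.
  by rewrite -(psiE c x) /diff addrC addrNK.
have psiV c x : psi ((presented_gen _ c)^-1 * x)%g
    = act (presented_gen _ c)^-1%g (psi x - k c).
  by rewrite -[x in RHS](mulVKg (presented_gen _ c)) psiM addrK (actVK actM act1).
have dE g x : psi (g * x)%g = act g (psi x) + d g.
  elim/presented_ind: g x => [|c g IHg|c g IHg] x.
  - by rewrite /d mul1g !act1 subrr addr0.
  - rewrite /d -mulgA !psiM IHg !actM (actD actB) -addrA; congr (_ + _).
    by rewrite /d actB addrAC.
  - rewrite /d -mulgA !psiV IHg !actM -addrA (actD actB); congr (_ + _).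
    by rewrite /d !actB addrAC.
have dM g h : d (g * h)%g = d g + act g (d h).
  have -> : d h = psi h - act h (psi 1%g) by [].
  by rewrite {1}/d dE actM actB addrAC addrC.
have da : d a = act wn p by rewrite /d -{1}[a]mulg1 (psiM true) addrC addKr.
have db : d b = p by rewrite /d -{1}[b]mulg1 (psiM false) addrC addKr.
have [q qE] := acyclic_derivation rhoA dM.
have wq : ((rho w : 'M_2) - 1%:M) *m q = 0.
  rewrite mulmxBl mul1mx -[LHS]qE; apply: (can_inj (actVK actM act1 (b * a^-1)%g)).
  by rewrite (deriv_wcomm actB act1 dM) da db -fox_mxE Ep (act0 actB).
have q0 : q = 0 by rewrite -(mulKmx Wu q) wq mulmx0.
by move: p0; rewrite -db qE q0 (act0 actB) subrr eqxx.
Qed.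

End TwistRepresentations.

(** * Pairs of matrices in normal form *)

Lemma ord2P (k : 'I_2) : k = 0 \/ k = 1.
Proof. by case: k => [[|[|//]] kp]; [left | right]; apply: val_inj. Qed.

Section TwoByTwo.
Variable F : fieldType.
Implicit Types (a b c d : F) (M N : 'M[F]_2).

Definition mx2 a b c d : 'M[F]_2 :=
  \matrix_(i, j) if i == 0 then (if j == 0 then a else b) else (if j == 0 then c else d).

Lemma mx2P M N : M 0 0 = N 0 0 -> M 0 1 = N 0 1 -> M 1 0 = N 1 0 -> M 1 1 = N 1 1 ->
  M = N.
Proof.
move=> E1 E2 E3 E4; apply/matrixP => i j.
by case: (ord2P i) (ord2P j) => -> [] ->.
Qed.

Lemma mx2E M : M = mx2 (M 0 0) (M 0 1) (M 1 0) (M 1 1).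
Proof. by apply: mx2P; rewrite !mxE. Qed.

Lemma mul_mx2 a b c d a' b' c' d' : mx2 a b c d *m mx2 a' b' c' d'
  = mx2 (a * a' + b * c') (a * b' + b * d') (c * a' + d * c') (c * b' + d * d').
Proof. by apply: mx2P; rewrite mulmx2E !mxE. Qed.

Lemma add_mx2 a b c d a' b' c' d' :
  mx2 a b c d + mx2 a' b' c' d' = mx2 (a + a') (b + b') (c + c') (d + d').
Proof. by apply: mx2P; rewrite !mxE. Qed.

Lemma opp_mx2 a b c d : - mx2 a b c d = mx2 (- a) (- b) (- c) (- d).
Proof. by apply: mx2P; rewrite !mxE. Qed.

Lemma scale_mx2 k a b c d : k *: mx2 a b c d = mx2 (k * a) (k * b) (k * c) (k * d).
Proof. by apply: mx2P; rewrite !mxE. Qed.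

Lemma scalar_mx2 k : k%:M = mx2 k 0 0 k.
Proof. by apply: mx2P; rewrite !mxE /=. Qed.

Lemma det_mx2 a b c d : \det (mx2 a b c d) = a * d - b * c.
Proof. by rewrite det2 !mxE. Qed.

Lemma tr_mx2 a b c d : \tr (mx2 a b c d) = a + d.
Proof.
rewrite /mxtrace !big_ord_recl big_ord0 addr0 !mxE /=.
by [].
Qed.

Definition mx2_simp := (mul_mx2, add_mx2, opp_mx2, scale_mx2, scalar_mx2, det_mx2, tr_mx2).

Lemma mxtrace2 M : \tr M = M 0 0 + M 1 1.
Proof. by rewrite [in LHS](mx2E M) tr_mx2. Qed.

Lemma SL2_invE (A : SL2 F) : (A^-1%g : 'M_2) = mx2 (A 1 1) (- A 0 1) (- A 1 0) (A 0 0).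
Proof.
have dA := SL2_det A; rewrite det2 in dA.
rewrite -[LHS]mulmx1.
have -> : 1%:M = A *m mx2 (A 1 1) (- A 0 1) (- A 1 0) (A 0 0) :> 'M_2.
  rewrite {1}[A : 'M_2]mx2E !mx2_simp; congr mx2; rewrite -?dA; ring.
by rewrite mulmxA /= mulVmx ?SL2_unit // mul1mx.
Qed.

Lemma SL2_mulE (A B : SL2 F) : ((A * B)%g : 'M_2) = (A : 'M_2) *m (B : 'M_2).
Proof. by []. Qed.

Lemma SL2_inv_trace (A : SL2 F) : (A^-1%g : 'M_2) = (\tr A)%:M - (A : 'M_2).
Proof.
rewrite SL2_invE mxtrace2 [in X in _ - X](mx2E A) !mx2_simp.
by congr mx2; ring.
Qed.

Lemma SL2_ex M : \det M = 1 -> exists A : SL2 F, A = M :> 'M_2.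
Proof. by move=> /eqP dM; exists (MkSL2 dM). Qed.

Lemma SL2_cayley (A : SL2 F) : (A : 'M_2) *m A = \tr A *: (A : 'M_2) - 1%:M.
Proof.
have : (A : 'M_2) *m (A^-1%g : 'M_2) = 1%:M by rewrite -SL2_mulE mulgV.
rewrite SL2_inv_trace mulmxBr mul_mx_scalar => <-.
by rewrite opprB addrC addrNK.
Qed.

(** By Cayley-Hamilton the span of A and 1 is closed under multiplication by A, and the inverse is
    the trace minus the matrix. *)
Lemma gexpz_linear (A : SL2 F) (n : int) :
  exists k l : F, (gexpz A n : 'M_2) = k *: (A : 'M_2) + l%:M.
Proof.
have linX j : exists k l : F, ((A ^+ j)%g : 'M_2) = k *: (A : 'M_2) + l%:M.
  elim: j => [|j [k [l E]]]; first by exists 0, 1; rewrite scale0r add0r.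
  exists (k * \tr A + l), (- k).
  rewrite expgS SL2_mulE E mulmxDr -scalemxAr SL2_cayley scalerBr scalerA.
  by rewrite mul_mx_scalar scalerDl -[(- k)%:M]scalemx1 scaleNr addrAC.
have [j [k [l E]]] : exists j k (l : F), ((A ^+ j)%g : 'M_2) = k *: (A : 'M_2) + l%:M
   /\ (gexpz A n = (A ^+ j)%g \/ gexpz A n = (A ^- j)%g).
  by case: n => j; [have [k [l E]] := linX j | have [k [l E]] := linX j.+1];
    [exists j | exists j.+1]; exists k, l; split=> //; [left | right].
case: E => E [->|->]; first by exists k, l.
exists (- k), (\tr ((A ^+ j)%g : 'M_2) - l).
rewrite SL2_inv_trace E opprD scaleNr addrCA; congr (_ + _).
by rewrite raddfB.
Qed.

End TwoByTwo.

Section NormalForm.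
Variables (F : fieldType) (n : int).
Implicit Types (A B : SL2 F) (m u : F).

Definition twist_pair A B :=
  (A * gexpz (wcomm A B) n = gexpz (wcomm A B) n * B)%g.

Definition fox_pair A B : 'M[F]_2 :=
  ((A^-1%g : 'M_2) - 1%:M)
  + ((B : 'M_2) - 1%:M) *m (A^-1%g : 'M_2) *m (gexpz (wcomm A B) n : 'M_2).

(** Riley's normal form: A upper and B lower triangular with the same trace, the parameter u fixing
    the trace of the product. *)
Definition normal_pair m u A B :=
  [/\ m != 0, (A : 'M_2) = mx2 m 1 0 m^-1 & (B : 'M_2) = mx2 m 0 (- u) m^-1].

Section OnePair.
Variables (m u : F) (A B : SL2 F).
Hypothesis AB : normal_pair m u A B.
Let m0 : m != 0. Proof. by case: AB. Qed.
Let AE : (A : 'M_2) = mx2 m 1 0 m^-1. Proof. by case: AB. Qed.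
Let BE : (B : 'M_2) = mx2 m 0 (- u) m^-1. Proof. by case: AB. Qed.
Let x := m + m^-1.
Let y := m ^+ 2 + m^-1 ^+ 2 - u.
Local Notation w := (wcomm A B).

Lemma normal_inv : (A^-1%g : 'M_2) = mx2 m^-1 (-1) 0 m.
Proof. by rewrite SL2_invE AE !mxE /= oppr0. Qed.

Lemma normal_invB : (B^-1%g : 'M_2) = mx2 m^-1 0 u m.
Proof. by rewrite SL2_invE BE !mxE /= oppr0 opprK. Qed.

Lemma normal_trA : \tr (A : 'M_2) = x.
Proof. by rewrite AE tr_mx2. Qed.

Lemma normal_trAB : \tr ((A * B)%g : 'M_2) = y.
Proof. by rewrite SL2_mulE AE BE !mx2_simp /y; field. Qed.

Lemma normal_w : (w : 'M_2) = mx2 ((1 + u) ^+ 2 - u * m ^+ 2) (m - (1 + u) * m^-1)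
  (- u * (m - (1 + u) * m^-1)) (1 - u * m^-1 ^+ 2).
Proof.
rewrite /wcomm !SL2_mulE normal_inv normal_invB AE BE !mx2_simp.
by congr mx2; field.
Qed.

Lemma normal_trw : \tr (w : 'M_2) = 2 + u * (2 - y).
Proof. by rewrite normal_w tr_mx2 /y; field. Qed.

Lemma normal_det_w1 : \det ((w : 'M_2) - 1%:M) = u * (y - 2).
Proof. by rewrite normal_w !mx2_simp /y; field. Qed.

(** Equivalently A (w + 1 - y) = (w + 1 - y) B: the matrix w + 1 - y solves the relation in place of
    w^n. *)
Lemma normal_kappa : (w : 'M_2) *m B - (A : 'M_2) *m w = (1 - y) *: ((A : 'M_2) - (B : 'M_2)).
Proof. by rewrite normal_w AE BE !mx2_simp /y; congr mx2; field. Qed.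

Definition power_eq k := (gexpz w n : 'M_2) = k *: ((w : 'M_2) + (1 - y)%:M).

Lemma power_eq_twist k : power_eq k -> twist_pair A B.
Proof.
move=> E; apply: val_inj; rewrite /= E -scalemxAl -scalemxAr; congr (_ *: _).
rewrite mulmxDr mulmxDl mul_mx_scalar mul_scalar_mx.
have /eqP := normal_kappa; rewrite subr_eq scalerBr => /eqP ->.
by rewrite addrAC addrNK addrC.
Qed.

Lemma normal_neq : A <> B.
Proof.
move=> /(congr1 (fun M : SL2 F => (M : 'M_2) 0 1)); rewrite AE BE !mxE /=.
by move=> /eqP; rewrite oner_eq0.
Qed.

(** Write w^n = k w + l. By [normal_kappa] the relation forces (k (1 - y) - l)(A - B) = 0, and A
    differs from B. *)
Lemma twist_power_eq : twist_pair A B -> exists k, power_eq k.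
Proof.
move=> ABn; have [k [l E]] := gexpz_linear w n; exists k.
rewrite /power_eq E scalerDr; congr (_ + _).
have : (k * (1 - y) - l) *: ((A : 'M_2) - (B : 'M_2)) = 0.
  have := congr1 (fun M : SL2 F => (M : 'M_2)) ABn.
  rewrite !SL2_mulE E mulmxDr mulmxDl mul_mx_scalar mul_scalar_mx -scalemxAl -scalemxAr.
  move=> /eqP; rewrite eq_sym -subr_eq0 opprD addrACA -!scalerBr normal_kappa scalerA.
  by rewrite -[(B : 'M_2) - (A : 'M_2)]opprB scalerN -scalerBl => /eqP.
move=> /(congr1 (fun M : 'M[F]_2 => M 0 1)); rewrite AE BE !mxE /= subr0 mulr1.
by move=> /subr0_eq <-; rewrite scale_scalar_mx.
Qed.

Lemma power_eq_det k : power_eq k ->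
  k ^+ 2 * ((2 - y) * (y + (2 + u) - y * (2 + u))) = 1.
Proof.
move=> E; transitivity (\det (gexpz w n : 'M_2)); last exact: SL2_det.
by rewrite E normal_w !mx2_simp /y; field.
Qed.

Lemma det_fox_pair k : power_eq k ->
  \det (fox_pair A B) = 2 * ((2 - x) - k * (y - 2) * (x - (2 + u))).
Proof.
move=> E; have D := power_eq_det E.
have -> : 2 * (2 - x - k * (y - 2) * (x - (2 + u))) =
  (2 - x) * (1 + k ^+ 2 * ((2 - y) * (y + (2 + u) - y * (2 + u))))
  - 2 * k * (y - 2) * (x - (2 + u)) by rewrite D; ring.
rewrite /fox_pair E normal_w normal_inv BE !mx2_simp /y /x.
by field.
Qed.

Lemma det_fox_pair_eq0 k : (2 : F) != 0 -> u != 0 -> power_eq k ->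
  (\det (fox_pair A B) == 0) = (y == x) && (k * x * (x - 2) == 1).
Proof.
move=> two0 u0 E; have D := power_eq_det E; rewrite (det_fox_pair E) mulf_eq0 (negPf two0) /=.
have uE : 2 + u = x ^+ 2 - y by rewrite /x /y; field.
have y2 : y - 2 != 0.
  by apply/eqP => y2; move/eqP: D; rewrite -[2 - y]opprB y2 oppr0 mul0r mulr0 eq_sym oner_eq0.
have k0 : k != 0.
  by apply/eqP => k0; move/eqP: D; rewrite k0 expr0n mul0r eq_sym oner_eq0.
apply/eqP/andP => [h|[/eqP yx /eqP kx]]; last first.
  have -> : 2 - x - k * (y - 2) * (x - (2 + u)) = (2 - x) * (1 - k * x * (x - 2)).
    by rewrite uE yx; ring.
  by rewrite kx subrr mulr0.
have hh : 2 - x = k * (y - 2) * (x - (2 + u)) by apply/subr0_eq.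
(* Squaring hh and eliminating k with the determinant equation leaves a polynomial that factors. *)
have : (y - 2) * (y - x) ^+ 2 * u = 0.
  apply: (mulfI (expf_neq0 2 k0)); rewrite mulr0.
  have -> : u = x ^+ 2 - y - 2 by rewrite -uE addrC addKr.
  transitivity ((k ^+ 2 * ((2 - y) * (y + (2 + u) - y * (2 + u)))) * (2 - x) ^+ 2
     - (k * (y - 2) * (x - (2 + u))) ^+ 2); last by rewrite D -hh mul1r subrr.
  by rewrite uE; ring.
move=> /eqP; rewrite !mulf_eq0 (negPf y2) (negPf u0) orbF orbb subr_eq0 => yx.
split; first exact: yx.
move: hh; rewrite uE (eqP yx) => hh.
have x2 : x - 2 != 0 by rewrite -(eqP yx).
by apply/eqP/(mulIf x2); rewrite mul1r; apply: oppr_inj; rewrite opprB [RHS]hh; ring.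
Qed.

End OnePair.
End NormalForm.

(** * Conjugation into normal form *)

Definition shared_eigenvector (F : fieldType) (A B : 'M[F]_2) (v : 'cV[F]_2) :=
  [/\ v != 0, exists k, A *m v = k *: v & exists k, B *m v = k *: v].

Section Conjugation.
Variables (F : fieldType) (n : int).
Implicit Types (A B P : SL2 F).

Definition sl2_conj P A := (P * A * P^-1)%g.

Lemma sl2_conj_hom P : is_hom (sl2_conj P).
Proof. by move=> A B; rewrite /sl2_conj !mulgA mulgVK. Qed.

Lemma sl2_conjE P A :
  (sl2_conj P A : 'M_2) = (P : 'M_2) *m (A : 'M_2) *m invmx (P : 'M_2).
Proof. by []. Qed.

Lemma hom_wcomm (G H : groupType) (f : G -> H) : is_hom f ->
  forall a b, f (wcomm a b) = wcomm (f a) (f b).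
Proof. by move=> fM a b; rewrite /wcomm !fM !(homV fM). Qed.

Lemma det_fox_pair_conj P A B :
  \det (fox_pair n (sl2_conj P A) (sl2_conj P B)) = \det (fox_pair n A B).
Proof.
pose c (M : 'M[F]_2) := (P : 'M_2) *m M *m invmx (P : 'M_2).
have cM M N : c (M *m N) = c M *m c N.
  by rewrite /c !mulmxA mulmxKV ?SL2_unit.
have cB M N : c (M - N) = c M - c N by rewrite /c mulmxBr mulmxBl.
have cD M N : c (M + N) = c M + c N by rewrite /c mulmxDr mulmxDl.
have c1 : c 1%:M = 1%:M by rewrite /c mulmx1 mulmxV ?SL2_unit.
have -> : fox_pair n (sl2_conj P A) (sl2_conj P B) = c (fox_pair n A B).
  rewrite /fox_pair -(homV (sl2_conj_hom P)) -(hom_wcomm (sl2_conj_hom P)).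
  rewrite -(hom_gexpz (sl2_conj_hom P)) cD cM cM !cB c1.
  by [].
by rewrite /c !det_mulmx det_inv mulrAC divff ?mul1r // SL2_det oner_neq0.
Qed.

Lemma twist_pair_conj P A B : twist_pair n A B ->
  twist_pair n (sl2_conj P A) (sl2_conj P B).
Proof.
have PM := sl2_conj_hom P; move=> AB; rewrite /twist_pair.
by rewrite -(hom_wcomm PM) -(hom_gexpz PM) -!PM AB.
Qed.

Lemma sl2_conj_trace P A : \tr (sl2_conj P A : 'M_2) = \tr (A : 'M_2).
Proof. by rewrite mxtrace_mulC mulmxA mulVmx ?SL2_unit // mul1mx. Qed.

End Conjugation.

Section ClosedField.
Variable F : numClosedFieldType.
Implicit Types (A B P : SL2 F).

Lemma inverse_sum_ex (t : F) : exists2 z : F, z != 0 & z + z^-1 = t.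
Proof.
pose s := sqrtC (t ^+ 2 - 4); pose z := (t + s) / 2.
have zE : z * (t - z) = 1.
  have -> : z * (t - z) = (t ^+ 2 - s ^+ 2) / 4 by rewrite /z; field.
  by rewrite sqrtCK; field.
have z0 : z != 0 by apply/eqP => z0; move/eqP: zE; rewrite z0 mul0r eq_sym oner_eq0.
exists z => //; apply: (mulfI z0); rewrite mulrDr divff //.
by rewrite -zE; ring.
Qed.

Lemma eigenvector_ex A m : m != 0 -> \tr (A : 'M_2) = m + m^-1 ->
  exists2 v : 'cV[F]_2, v != 0 & (A : 'M_2) *m v = m *: v.
Proof.
move=> m0 trA; have [|v v0 Av] := @singular_kernel F 2 ((A : 'M_2) - m%:M).
  rewrite unitmxE unitfE negbK det2 !mxE /= !mulr1n !mulr0n !subr0.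
  have := SL2_det A; rewrite det2 => dA; move: trA; rewrite mxtrace2 => trA.
  have -> : (A 0 0 - m) * (A 1 1 - m) - A 0 1 * A 1 0
    = (A 0 0 * A 1 1 - A 0 1 * A 1 0) - m * (A 0 0 + A 1 1) + m ^+ 2 by ring.
  by rewrite dA trA; apply/eqP; field.
exists v => //; apply/eqP; rewrite -subr_eq0 -mul_scalar_mx -mulmxBl.
exact/eqP.
Qed.

(** An eigenvector e of A for m and an eigenvector f of B for 1/m form a basis, in which A is upper
    and B lower triangular. A diagonal rescaling then normalises the corner of A. *)
Lemma normal_form_ex A B m : m != 0 ->
  \tr (A : 'M_2) = m + m^-1 -> \tr (B : 'M_2) = m + m^-1 ->
  (forall v, ~ shared_eigenvector A B v) ->
  exists P u, normal_pair m u (sl2_conj P A) (sl2_conj P B).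
Proof.
move=> m0 trA trB AB.
have [e e0 Ae] := eigenvector_ex m0 trA.
have [|f f0 Bf] := @eigenvector_ex B m^-1 (invr_neq0 m0).
  by rewrite trB invrK addrC.
pose Q := mx2 (e 0 0) (f 0 0) (e 1 0) (f 1 0).
have QE (v : 'cV[F]_2) : Q *m v = v 0 0 *: e + v 1 0 *: f.
  apply/matrixP => i j; rewrite ord1 mulmx2E /Q !mxE.
  have [->|->] := ord2P i.
    by rewrite /= mulrC [X in _ + X]mulrC.
  by rewrite /= mulrC [X in _ + X]mulrC.
have Qu : Q \in unitmx.
  apply/negPn/negP => /singular_kernel[v v0]; rewrite QE => vE.
  have [v1|v1] := eqVneq (v 1 0) 0.
    move: vE; rewrite v1 scale0r addr0 => /eqP; rewrite scaler_eq0 (negPf e0) orbF.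
    move=> /eqP v00; move/eqP: v0; apply; apply/matrixP => i j; rewrite ord1 mxE.
    by case: (ord2P i) => ->.
  have fE : f = - (v 0 0 / v 1 0) *: e.
    apply: (scalerI v1); rewrite scalerA mulrN mulrCA divff // mulr1 scaleNr.
    by apply/eqP; rewrite -addr_eq0 addrC vE.
  apply: (AB f); split=> //; last by exists m^-1.
  by exists m; rewrite fE -scalemxAr Ae !scalerA mulrC.
pose M (C : 'M[F]_2) := invmx Q *m C *m Q.
have QM C : Q *m M C = C *m Q by rewrite /M -mulmxA mulKVmx.
have trM C : \tr (M C) = \tr C by rewrite /M mxtrace_mulC mulKVmx.
have Q0 : Q *m delta_mx 0 0 = e by rewrite QE !mxE /= scale1r scale0r addr0.
have Q1 : Q *m delta_mx 1 0 = f by rewrite QE !mxE /= scale1r scale0r add0r.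
have MA : M A *m delta_mx 0 0 = m *: delta_mx 0 0 :> 'cV_2.
  by rewrite /M -!mulmxA Q0 Ae -scalemxAr -Q0 mulKmx.
have MB : M B *m delta_mx 1 0 = m^-1 *: delta_mx 1 0 :> 'cV_2.
  by rewrite /M -!mulmxA Q1 Bf -scalemxAr -Q1 mulKmx.
have entry (C : 'M[F]_2) i j : C i j = (C *m delta_mx j 0 : 'cV_2) i 0.
  by rewrite -colE mxE.
pose c := M A 0 1; pose d := M B 1 0.
have MAE : M A = mx2 m c 0 m^-1.
  have M00 : M A 0 0 = m by rewrite entry MA !mxE mulr1.
  have M10 : M A 1 0 = 0 by rewrite entry MA !mxE mulr0.
  rewrite [LHS]mx2E M00 M10; congr mx2.
  by have := trM A; rewrite trA mxtrace2 M00 => /addrI.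
have MBE : M B = mx2 m 0 d m^-1.
  have M11 : M B 1 1 = m^-1 by rewrite entry MB !mxE mulr1.
  have M01 : M B 0 1 = 0 by rewrite entry MB !mxE mulr0.
  rewrite [LHS]mx2E M11 M01; congr mx2.
  by have := trM B; rewrite trB mxtrace2 M11 => /addIr.
have c0 : c != 0.
  apply/eqP => c0; apply: (AB f); split=> //; last by exists m^-1.
  exists m^-1; rewrite -Q1 mulmxA -QM -mulmxA MAE c0 scalemxAr; congr (_ *m _).
  by apply/matrixP => i j; rewrite ord1 mulmx2E !mxE /=; case: (ord2P i) => ->; rewrite /=; ring.
have detQ : \det Q != 0 by rewrite -unitfE -unitmxE.
(* The ratio c in [D] makes the corner of A equal to 1; t gives the change of basis determinant
   1. *)
pose t := sqrtC ((c * \det Q)^-1).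
have tE : t ^+ 2 * (c * \det Q) = 1 by rewrite sqrtCK mulVf // mulf_neq0.
have t0 : t != 0.
  by apply/eqP => t0; move/eqP: tE; rewrite t0 expr0n mul0r eq_sym oner_eq0.
pose D := mx2 (t * c) 0 0 t.
have [P PE] : exists P : SL2 F, P = Q *m D :> 'M_2.
  apply: SL2_ex; rewrite det_mulmx [\det D]det_mx2 -tE; ring.
have conjE (C : SL2 F) N :
    (C : 'M_2) *m (P : 'M_2) = (P : 'M_2) *m N -> (sl2_conj P^-1%g C : 'M_2) = N.
  move=> E; rewrite /sl2_conj invgK !SL2_mulE -mulmxA E mulmxA.
  by rewrite -SL2_mulE mulVg mul1mx.
exists P^-1%g, (- (d * c)); split=> //; apply: conjE;
  rewrite PE mulmxA -QM -[LHS]mulmxA -[RHS]mulmxA.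
  by rewrite MAE /D; congr (_ *m _); rewrite !mx2_simp; congr mx2; field.
by rewrite MBE /D; congr (_ *m _); rewrite !mx2_simp; congr mx2; field.
Qed.

End ClosedField.

(** * Irreducibility in terms of the two generators *)

Section Irreducible.
Variables (F : fieldType) (n : int) (rho : {multiplicative twist_group n -> SL2 F}).
Local Notation a := (twist_a n).
Local Notation b := (twist_b n).
Local Notation w := (twist_w n).
Local Notation act := (rep_act rho).

Lemma irreducible_no_shared_eigenvector : irreducible_rep rho ->
  forall v, ~ shared_eigenvector (rho a : 'M_2) (rho b : 'M_2) v.
Proof.
move=> irr v [v0 [ka Av] [kb Bv]].
have eigV g k : act g v = k *: v -> exists l, act g^-1%g v = l *: v.
  move=> gv; have gvE : v = k *: act g^-1%g v.
    transitivity (act g^-1%g (act g v)).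
      by rewrite (actVK (rep_actM rho) (rep_act1 rho)).
    by rewrite gv /rep_act scalemxAr.
  have k0 : k != 0 by apply/eqP => k0; move: v0; rewrite gvE k0 scale0r eqxx.
  by exists k^-1; rewrite [in RHS]gvE scalerA mulVf // scale1r.
have eigM g h : (exists k, act g v = k *: v) -> (exists k, act h v = k *: v) ->
    exists k, act (g * h)%g v = k *: v.
  move=> [k gv] [l hv]; exists (l * k); rewrite (rep_actM rho) hv.
  by rewrite /rep_act -scalemxAr -/(act g v) gv scalerA.
have eig g : exists k, act g v = k *: v.
  elim/twist_ind: g => [|g|g|g|g].
  - by exists 1; rewrite (rep_act1 rho) scale1r.
  - by apply: eigM; exists ka.
  - by apply: eigM; exists kb.
  - by apply: eigM; exact: eigV Av.
  - by apply: eigM; exact: eigV Bv.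
have [|V0|VT] := irr <[v]>%VS.
- move=> g _ /vlineP[k ->]; have [l gv] := eig g.
  by rewrite -scalemxAr -/(act g v) gv scalerA memvZ // memv_line.
- by move: (memv_line v); rewrite V0 memv0 (negPf v0).
- have := dim_vline v; rewrite VT v0 dimvf dim_matrix.
  by [].
Qed.

Lemma no_shared_eigenvector_irreducible :
  (forall v, ~ shared_eigenvector (rho a : 'M_2) (rho b : 'M_2) v) ->
  irreducible_rep rho.
Proof.
move=> AB V Vinv; have [->|V0] := eqVneq V 0%VS; first by left.
right; apply/eqP; apply/negPn/negP => VT.
have v0 : vpick V != 0 by rewrite vpick0.
have VE : V = <[vpick V]>%VS.
  apply/esym/eqP; rewrite eqEdim -memvE memv_pick /= dim_vline v0.
  have : (\dim V < \dim (fullv : {vspace 'cV[F]_2}))%N.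
    rewrite ltn_neqAle dimvS ?subvf // andbT; apply: contraNN VT => /eqP dV.
    by rewrite eqEdim subvf dV /=.
  by rewrite dimvf dim_matrix.
have eig g : exists k, (rho g : 'M_2) *m vpick V = k *: vpick V.
  by apply/vlineP; rewrite -VE; apply: Vinv; exact: memv_pick.
exact: AB (And3 v0 (eig a) (eig b)).
Qed.

Lemma irreducible_fixed : irreducible_rep rho ->
  forall p, (forall g, act g p = p) -> p = 0.
Proof.
move=> irr p fix_p; apply/eqP/negPn/negP => p0.
apply: (irreducible_no_shared_eigenvector irr (v := p)).
by split=> //; exists 1; rewrite scale1r; exact: fix_p.
Qed.

Lemma rep_w : rho w = wcomm (rho a) (rho b).
Proof. exact: hom_wcomm (rep_hom rho) _ _. Qed.

Lemma rep_twist_pair : twist_pair n (rho a) (rho b).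
Proof.
rewrite /twist_pair -rep_w -(hom_gexpz (rep_hom rho)).
by rewrite -!(rep_hom rho) twist_relE.
Qed.

Lemma rep_trace_eq : \tr (rho b : 'M_2) = \tr (rho a : 'M_2).
Proof.
have -> : rho b = sl2_conj (gexpz (rho w) n)^-1%g (rho a).
  rewrite /sl2_conj invgK -mulgA rep_w; have := rep_twist_pair; rewrite /twist_pair => ->.
  by rewrite mulKg.
exact: sl2_conj_trace.
Qed.

Lemma rep_fox_mx : fox_mx rho = fox_pair n (rho a) (rho b).
Proof.
rewrite /fox_mx /fox_pair (homV (rep_hom rho)) (hom_gexpz (rep_hom rho)).
by rewrite rep_w.
Qed.

Lemma SL2_det_sub1 (A : SL2 F) : \det ((A : 'M_2) - 1%:M) = 2 - \tr (A : 'M_2).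
Proof.
rewrite det2 !mxE /= mxtrace2; have := SL2_det A; rewrite det2 => dA.
transitivity (A 0 0 * A 1 1 - A 0 1 * A 1 0 - (A 0 0 + A 1 1) + 1); first by ring.
by rewrite dA; ring.
Qed.

End Irreducible.

(** * Roots of unity *)

Section Powers.
Variable F : numClosedFieldType.
Implicit Types (W : SL2 F) (n : int).

(** The recursion also runs backwards since W is invertible. *)
Lemma gexpz_unique W (f : int -> 'M[F]_2) : f 0 = 1%:M ->
  (forall n, f (n + 1) = f n *m (W : 'M_2)) -> forall n, (gexpz W n : 'M_2) = f n.
Proof.
move=> f0 fS; elim/int_ind => [|k IHk|k IHk]; first by rewrite f0.
  have -> : (k.+1%:Z = k%:Z + 1)%R by lia.
  by rewrite gexpzS SL2_mulE IHk fS.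
have E : (- k.+1%:Z + 1)%R = (- k%:Z)%R by lia.
have := congr1 (fun M => M *m invmx (W : 'M_2)) (fS (- k.+1%:Z)).
rewrite E -IHk -[in X in X = _]E gexpzS SL2_mulE !mulmxK ?SL2_unit //.
Qed.

Lemma gexpz_trace W (l : F) n : l != 0 -> l - l^-1 != 0 ->
  \tr (W : 'M_2) = l + l^-1 ->
  (gexpz W n : 'M_2) = ((l ^ n - (l ^ n)^-1) / (l - l^-1)) *: (W : 'M_2)
    - ((l ^ n / l - l / l ^ n) / (l - l^-1))%:M.
Proof.
move=> l0 ll trW.
pose f n := ((l ^ n - (l ^ n)^-1) / (l - l^-1)) *: (W : 'M_2)
    - ((l ^ n / l - l / l ^ n) / (l - l^-1))%:M.
have l1 : l * l - 1 != 0.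
  by apply: contraNneq ll => l1; rewrite -(mulfK l0 (l - _)) mulrBl mulVf // l1 mul0r.
rewrite -[RHS]/(f n); apply: gexpz_unique => [|j].
  rewrite /f expr0z invr1 subrr mul0r scale0r sub0r -raddfN; congr (_ %:M).
  by rewrite mul1r mulr1 -mulNr opprB divff.
have p0 : l ^ j != 0 by rewrite expfz_neq0.
rewrite /f expfzDr // expr1z; move: (l ^ j) p0 => p p0.
rewrite mulmxBl -scalemxAl SL2_cayley mul_scalar_mx trW.
rewrite scalerBr scalerA addrAC -scalerBl; congr (_ *: _ - _).
  by field; rewrite l0 l1.
rewrite scale_scalar_mx mulr1; congr (_ %:M).
by field; rewrite l0 l1.
Qed.

(** Here (W + 1)^2 = 0, so -W is unipotent. *)
Lemma gexpz_parabolic W n : \tr (W : 'M_2) = - 2 ->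
  (gexpz W n : 'M_2) = ((-1) ^ n) *: (1%:M - n%:~R *: ((W : 'M_2) + 1%:M)).
Proof.
move=> trW; pose f (j : int) := ((-1) ^ j) *: (1%:M - j%:~R *: ((W : 'M_2) + 1%:M)).
rewrite -[RHS]/(f n); apply: gexpz_unique => [|j].
  by rewrite /f expr0z scale0r subr0 scale1r.
have W1 : ((W : 'M_2) + 1%:M) *m (W : 'M_2) = - ((W : 'M_2) + 1%:M).
  rewrite mulmxDl SL2_cayley mul1mx trW scaleNr scaler_nat mulr2n.
  by rewrite addrAC opprD addrNK opprD.
rewrite /f expfzDr ?oppr_eq0 ?oner_eq0 // expr1z mulrN1 -scalemxAl mulmxBl mul1mx.
rewrite -scalemxAl W1 scaleNr -scalerN; congr (_ *: _).
by rewrite scalerN opprK opprB intrD scalerDl scale1r -addrA addrK addrC.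
Qed.

Lemma gexpz_eigen W n (v : 'cV[F]_2) (l : F) : l != 0 ->
  (W : 'M_2) *m v = l *: v -> (gexpz W n : 'M_2) *m v = l ^ n *: v.
Proof.
move=> l0 Wv; have WX k : ((W ^+ k)%g : 'M_2) *m v = l ^+ k *: v.
  elim: k => [|k IHk]; first by rewrite mul1mx scale1r.
  by rewrite expgS SL2_mulE -mulmxA IHk -scalemxAr Wv scalerA exprSr.
case: n => k /=; first exact: WX.
have lk : l ^+ k.+1 != 0 by rewrite expf_neq0.
apply: (scalerI lk); rewrite scalerA divff // scale1r scalemxAr -WX.
by rewrite mulKmx ?SL2_unit.
Qed.

End Powers.

Section RootOfUnity.
Variables (F : numClosedFieldType) (n : int) (m u : F) (A B : SL2 F).
Hypothesis AB : normal_pair m u A B.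
Local Notation w := (wcomm A B).
Let m0 : m != 0. Proof. by case: AB. Qed.
Let x := m + m^-1.
Let y := m ^+ 2 + m^-1 ^+ 2 - u.
Hypothesis yx : y = x.

Let uE : u = x ^+ 2 - x - 2.
Proof.
have : u = x ^+ 2 - y - 2 by rewrite /x /y; field.
by rewrite yx.
Qed.

Lemma trw_zeta (z : F) : z != 0 -> x = 1 - (z + z^-1) ->
  \tr (w : 'M_2) = z ^+ 3 + (z ^+ 3)^-1.
Proof.
move=> z0 xz; rewrite (normal_trw AB) -/y yx uE xz; field; exact: z0.
Qed.

(** As (z^3)^n = z and z^3 - z^-3 = (z - z^-1) x (x - 2), the closed formula of [gexpz_trace]
    simplifies to the required multiple of w + 1 - x. *)
Lemma zeta_power_eq (z : F) : z != 0 -> x = 1 - (z + z^-1) -> z ^+ 6 != 1 ->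
  z ^ (3 * n - 1) = 1 -> x * (x - 2) != 0 /\ power_eq n m u A B (x * (x - 2))^-1.
Proof.
move=> z0 xz z6 zn; have z3 : z ^+ 3 != 0 by rewrite expf_neq0.
have zz : z ^+ 3 - (z ^+ 3)^-1 != 0.
  apply: contra_neq z6 => /subr0_eq E.
  by rewrite -[6%N]/(3 + 3)%N exprD {2}E divff.
have E : z ^+ 3 - (z ^+ 3)^-1 = (z - z^-1) * (x * (x - 2)) by rewrite xz; field.
have [z1 x0] : z - z^-1 != 0 /\ x * (x - 2) != 0.
  by move: zz; rewrite E mulf_eq0 negb_or => /andP.
split=> //; rewrite /power_eq (gexpz_trace n z3 zz (trw_zeta z0 xz)).
have -> : (z ^+ 3) ^ n = z.
  rewrite exprnP exprz_exp -[X in z ^ X](subrK 1) expfzDr // zn mul1r.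
  exact: expr1z.
rewrite -/y yx scalerDr scale_scalar_mx -raddfN E; congr (_ *: _ + _ %:M).
  by rewrite invfM mulrA divff ?mul1r.
have -> : z / z ^+ 3 - z ^+ 3 / z = - ((z - z^-1) * (1 - x)) by rewrite xz; field.
by rewrite mulNr opprK invfM mulrACA divff // mul1r mulrC.
Qed.

(** On an eigenvector of w for z^3, w^n acts as z^(3n) and also as k (z^3 + 1 - x) = z k x (x - 2) =
    z. *)
Lemma power_eq_zeta k (z : F) : power_eq n m u A B k -> k * x * (x - 2) = 1 ->
  z != 0 -> x = 1 - (z + z^-1) -> u != 0 ->
  [/\ z ^ (3 * n - 1) = 1, z != 1 & z != -1].
Proof.
move=> kE kx z0 xz u0; have z3 : z ^+ 3 != 0 by rewrite expf_neq0.
have [v v0 wv] := eigenvector_ex z3 (trw_zeta z0 xz).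
have z3n : (z ^+ 3) ^ n = z.
  have := gexpz_eigen n z3 wv; rewrite kE -scalemxAl mulmxDl wv mul_scalar_mx.
  rewrite -scalerDl scalerA => /eqP; rewrite -subr_eq0 -scalerBl scaler_eq0 (negPf v0) orbF.
  rewrite subr_eq0 => /eqP <-; rewrite -/y yx.
  transitivity (z * (k * x * (x - 2))); last by rewrite kx mulr1.
  by rewrite xz; field.
split.
- by rewrite expfzDr // -exprz_exp -exprnP z3n divff.
- apply: contraNneq u0 => z1; rewrite uE xz z1 invr1; apply/eqP; ring.
(* If z = -1 then w has trace -2 and w^n is affine in n. Comparing off-diagonal entries gives k = n
   up to sign, and 3 k = 1 is then impossible for an integer n. *)
apply/eqP => z1; have x3 : x = 3 by rewrite xz z1 invrN invr1; ring.
have k3 : 3 * k = 1 by transitivity (k * x * (x - 2)); [rewrite x3; ring | exact: kx].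
have trw : \tr (w : 'M_2) = - 2.
  by rewrite (trw_zeta z0 xz) z1 -signr_odd /= expr1 invrN invr1; ring.
have w01 : (w : 'M_2) 0 1 != 0.
  rewrite (normal_w AB) !mxE /=; apply/eqP => w01.
  have u4 : u = 4 by rewrite uE x3; ring.
  have m2 : m ^+ 2 = 5.
    apply/subr0_eq; rewrite -(mulfK m0 (m ^+ 2 - 5)).
    transitivity (m * (m - (1 + u) / m) * m / m); last by rewrite w01 mulr0 !mul0r.
    by rewrite u4; field.
  have m3 : 3 * (2 - m) = 0.
    transitivity (m * (x - 3)); last by rewrite x3 subrr mulr0.
    transitivity (m ^+ 2 + 1 - 3 * m); first by rewrite m2; ring.
    by rewrite /x; field.
  move/eqP: m3; rewrite mulf_eq0 pnatr_eq0 /= subr_eq0 => /eqP m2'.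
  have : (1 : F) = 0 by transitivity (5 - m ^+ 2); [rewrite -m2'; ring | rewrite m2 subrr].
  by move/eqP; rewrite oner_eq0.
have := gexpz_parabolic n trw; rewrite kE.
move: (w : 'M_2) w01 => M M01 /(congr1 (fun M : 'M[F]_2 => M 0 1)).
rewrite !mxE /= !mulr0n sub0r !addr0 mulrN mulrA -mulNr => /(mulIf M01) kn.
have : (3 * n) ^+ 2 = 1.
  apply: (@intr_inj F); rewrite rmorphXn rmorphM /=.
  have sq (j : int) : ((-1) ^ j) ^+ 2 = 1 :> F.
    by case: j => j; rewrite /exprz ?exprVn sqrr_sign ?invr1.
  transitivity ((3 * k) ^+ 2); last by rewrite k3 expr1n.
  by rewrite kn !exprMn sqrrN exprMn sq mul1r.
lia.
Qed.

End RootOfUnity.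

Lemma twist_pair_neq0 (F : fieldType) n (A B : SL2 F) :
  twist_pair n A B -> A <> B -> n != 0.
Proof.
by move=> ABn AB; apply/eqP => n0; move: ABn; rewrite /twist_pair n0 mulg1 mul1g.
Qed.

(** * Non-acyclic representations and their traces *)

Section TwistReps.
Variables (F : numClosedFieldType) (n : int).
Local Notation G := (twist_group n).
Local Notation a := (twist_a n).
Local Notation b := (twist_b n).
Implicit Type rho : {multiplicative twist_group n -> SL2 F}.

Lemma shared_eigenvector_conj (A B P : SL2 F) v :
  shared_eigenvector (sl2_conj P A : 'M_2) (sl2_conj P B : 'M_2) v ->
  shared_eigenvector (A : 'M_2) (B : 'M_2) (invmx (P : 'M_2) *m v).
Proof.
have E (C : SL2 F) k : (sl2_conj P C : 'M_2) *m v = k *: v ->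
    (C : 'M_2) *m (invmx (P : 'M_2) *m v) = k *: (invmx (P : 'M_2) *m v).
  move=> Cv; rewrite scalemxAr -Cv sl2_conjE -!mulmxA mulKmx ?SL2_unit //.
move=> [v0 [k Av] [l Bv]]; split; [|by exists k; exact: E|by exists l; exact: E].
apply: contraNneq v0 => v0.
by rewrite -(mulKVmx (SL2_unit P) v) v0 mulmx0.
Qed.

(** The commutator w would fix a shared eigenvector, but det (w - 1) = u (y - 2) is nonzero. *)
Lemma normal_no_shared m u (A B : SL2 F) v : normal_pair m u A B -> u != 0 ->
  m ^+ 2 + m^-1 ^+ 2 - u - 2 != 0 ->
  ~ shared_eigenvector (A : 'M_2) (B : 'M_2) v.
Proof.
move=> AB u0 y0 [v0 [k Av] [l Bv]].
have inv_eig (C : SL2 F) j : (C : 'M_2) *m v = j *: v ->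
    j != 0 /\ (C^-1%g : 'M_2) *m v = j^-1 *: v.
  move=> Cv; have vE : v = j *: ((C^-1%g : 'M_2) *m v).
    by rewrite scalemxAr -Cv /= mulKmx ?SL2_unit.
  have j0 : j != 0 by apply: contraNneq v0 => j0; rewrite vE j0 scale0r.
  by split=> //; rewrite [in RHS]vE scalerA mulVf // scale1r.
have [k0 AVv] := inv_eig A k Av; have [l0 BVv] := inv_eig B l Bv.
have wv : ((wcomm A B : 'M_2) - 1%:M) *m v = 0.
  rewrite mulmxBl mul1mx /wcomm !SL2_mulE -!mulmxA Bv -scalemxAr AVv scalerA.
  rewrite -scalemxAr BVv scalerA -scalemxAr Av scalerA.
  by rewrite (_ : _ * k = 1) ?scale1r ?subrr //; field; rewrite k0 l0.
have : (wcomm A B : 'M_2) - 1%:M \in unitmx.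
  by rewrite unitmxE unitfE (normal_det_w1 AB) mulf_neq0.
by move=> /mulKmx/(_ v); rewrite wv mulmx0 => v00; rewrite -v00 eqxx in v0.
Qed.

Lemma rep_normal_form rho m : irreducible_rep rho -> m != 0 ->
  \tr (rho a : 'M_2) = m + m^-1 ->
  exists P u, [/\ u != 0, \tr (rho (a * b)%g : 'M_2) = m ^+ 2 + m^-1 ^+ 2 - u &
    normal_pair m u (sl2_conj P (rho a)) (sl2_conj P (rho b))].
Proof.
move=> irr m0 trA; have AB := irreducible_no_shared_eigenvector irr.
have [|P [u nAB]] := normal_form_ex m0 trA _ AB; first by rewrite rep_trace_eq.
exists P, u; split=> //; last first.
  rewrite (rep_hom rho) -(sl2_conj_trace P) (sl2_conj_hom P).
  exact: normal_trAB nAB.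
apply/eqP => u0; case: nAB => _ AE BE.
apply: (AB (invmx (P : 'M_2) *m delta_mx 0 0)).
apply: shared_eigenvector_conj; split.
- by apply/eqP => /matrixP/(_ 0 0)/eqP; rewrite !mxE /= oner_eq0.
- exists m; rewrite AE; apply/matrixP => i j; rewrite ord1 mulmx2E !mxE.
  by case: (ord2P i) => -> /=; ring.
- exists m; rewrite BE u0 oppr0; apply/matrixP => i j; rewrite ord1 mulmx2E !mxE.
  by case: (ord2P i) => -> /=; ring.
Qed.

Definition zeta_params (z : F) rho :=
  [/\ z ^ (3 * n - 1) = 1, z != 1, z != -1,
   \tr (rho a : 'M_2) = 1 - (z + z^-1) & \tr (rho (a * b)%g : 'M_2) = 1 - (z + z^-1)].

Lemma zeta_neq0 (z : F) : z ^ (3 * n - 1) = 1 -> z != 0.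
Proof.
apply: contra_eqN => /eqP ->; rewrite exp0rz eq_sym (_ : _ == 0 = false) ?oner_eq0 //.
by lia.
Qed.

(** Since 2 (3n - 1) + 2 = 6n, z^6 = 1 would force z^2 = 1. *)
Lemma zeta6 (z : F) : z ^ (3 * n - 1) = 1 -> z != 1 -> z != -1 -> z ^+ 6 != 1.
Proof.
move=> zn z1 zN1; have z0 := zeta_neq0 zn.
apply/negP => /eqP z6; have /eqP : z ^+ 2 = 1.
  transitivity (z ^ (3 * n - 1) * z ^ (3 * n - 1) * z ^ (2 : int)).
    by rewrite zn !mul1r.
  rewrite -!expfzDr // (_ : _ + _ + _ = 6 * n)%R; last by lia.
  by rewrite -exprz_exp -[z ^ 6]exprnP z6 exp1rz.
by rewrite sqrf_eq1 (negPf z1) (negPf zN1).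
Qed.

Lemma not_acyclic_zeta rho : irreducible_rep rho ->
  ~ acyclic rho <-> exists z, zeta_params z rho.
Proof.
move=> irr; have [m m0 /esym trA] := inverse_sum_ex (\tr (rho a : 'M_2)).
have [P [u [u0 trAB nAB]]] := rep_normal_form irr m0 trA.
have n0 := twist_pair_neq0 (twist_pair_conj P (rep_twist_pair rho)) (normal_neq nAB).
have [k kE] := twist_power_eq nAB (twist_pair_conj P (rep_twist_pair rho)).
have D := power_eq_det nAB kE.
have y2 : 2 - (m ^+ 2 + m^-1 ^+ 2 - u) != 0.
  by apply: contra_eqN D => /eqP ->; rewrite mul0r mulr0 eq_sym oner_eq0.
(* det (w - 1) = 2 - tr w = u (y - 2), where y = 2 is excluded by the determinant of w^n. *)
have wu : (rho (twist_w n) : 'M_2) - 1%:M \in unitmx.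
  rewrite unitmxE unitfE SL2_det_sub1 rep_w -(sl2_conj_trace P).
  rewrite (hom_wcomm (sl2_conj_hom P)) (normal_trw nAB).
  by rewrite opprD addrA subrr sub0r oppr_eq0 mulf_neq0.
have na : ~ acyclic rho <-> \det (fox_pair n (rho a) (rho b)) == 0.
  rewrite -rep_fox_mx; split=> [nac|d0].
    apply/negPn/negP => d0; apply: nac; apply: twist_acyclic n0 (irreducible_fixed irr) wu _.
    by rewrite unitmxE unitfE.
  by apply: twist_not_acyclic wu _; rewrite unitmxE unitfE negbK.
have two0 : (2 : F) != 0 by rewrite pnatr_eq0.
rewrite na -(det_fox_pair_conj n P); split=> [|[z [zn z1 zN1 xz yz]]].
  rewrite (det_fox_pair_eq0 nAB two0 u0 kE) => /andP[/eqP yx /eqP kx].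
  have [z z0 xz] := inverse_sum_ex (1 - (m + m^-1)).
  have {}xz : m + m^-1 = 1 - (z + z^-1) by rewrite xz subKr.
  have [zn z1 zN1] := power_eq_zeta nAB yx kE kx z0 xz u0.
  by exists z; split=> //; rewrite ?trA ?trAB ?yx.
have z0 := zeta_neq0 zn; have z6 := zeta6 zn z1 zN1.
have yx : m ^+ 2 + m^-1 ^+ 2 - u = m + m^-1 by rewrite -trAB yz -xz trA.
have xz' : m + m^-1 = 1 - (z + z^-1) by rewrite -trA.
have [x0 kE'] := zeta_power_eq nAB yx z0 xz' z6 zn.
by rewrite (det_fox_pair_eq0 nAB two0 u0 kE') yx eqxx /= -mulrA mulVf.
Qed.

Lemma zeta_rep_ex z : z ^ (3 * n - 1) = 1 -> z != 1 -> z != -1 ->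
  exists rho, irreducible_rep rho /\ zeta_params z rho.
Proof.
move=> zn z1 zN1; have z0 := zeta_neq0 zn; have z6 := zeta6 zn z1 zN1.
pose x := 1 - (z + z^-1); have [m m0 xm] := inverse_sum_ex x.
(* The value of u for which the two traces coincide. *)
pose u := x ^+ 2 - x - 2.
have yx : m ^+ 2 + m^-1 ^+ 2 - u = x.
  have -> : m ^+ 2 + m^-1 ^+ 2 = x ^+ 2 - 2 by rewrite -xm; field.
  by rewrite /u; ring.
have [A AE] : exists A : SL2 F, A = mx2 m 1 0 m^-1 :> 'M_2.
  by apply: SL2_ex; rewrite det_mx2 mulr0 subr0 divff.
have [B BE] : exists B : SL2 F, B = mx2 m 0 (- u) m^-1 :> 'M_2.
  by apply: SL2_ex; rewrite det_mx2 mul0r subr0 divff.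
have AB : normal_pair m u A B by [].
have [x2 kE] : x * (x - 2) != 0 /\ power_eq n m u A B (x * (x - 2))^-1.
  have := zeta_power_eq AB _ z0 _ z6 zn; rewrite xm yx; exact.
have [f [fM fa fb]] := twist_lift (power_eq_twist AB kE).
pose rho : {multiplicative twist_group n -> SL2 F} :=
  HB.pack f (monoid.isMultiplicative.Build (twist_group n) (SL2 F) f fM).
have rhoa : rho a = A by []. have rhob : rho b = B by [].
have {}x2 : x - 2 != 0 by move: x2; rewrite mulf_eq0 negb_or => /andP[].
exists rho; split.
  apply: no_shared_eigenvector_irreducible => v; rewrite rhoa rhob.
  apply: (normal_no_shared AB).
    have -> : u = - ((x - 2) * (z - 1) ^+ 2 / z) by rewrite /u /x; field.
    by rewrite oppr_eq0 mulf_neq0 ?invr_neq0 // mulf_neq0 // expf_neq0 // subr_eq0.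
  by rewrite yx.
split=> //; first by rewrite rhoa (normal_trA AB) xm.
by rewrite (rep_hom rho) rhoa rhob (normal_trAB AB) yx.
Qed.

(** With the same m chosen for both, the second trace determines u, so both are conjugate to the
    same normal pair. *)
Lemma conjugate_rep_trace rho rho' : irreducible_rep rho -> irreducible_rep rho' ->
  conjugate_rep rho rho' <->
  \tr (rho a : 'M_2) = \tr (rho' a : 'M_2)
  /\ \tr (rho (a * b)%g : 'M_2) = \tr (rho' (a * b)%g : 'M_2).
Proof.
move=> irr irr'; split=> [[P PE]|[tra trab]].
  by split; rewrite PE; apply/esym; exact: sl2_conj_trace.
have [m m0 /esym trA] := inverse_sum_ex (\tr (rho a : 'M_2)).
have [P [u [_ trAB AB]]] := rep_normal_form irr m0 trA.
have [|P' [u' [_ trAB' AB']]] := rep_normal_form irr' m0 _; first by rewrite -tra.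
have uu : u = u' by move: trab; rewrite trAB trAB' => /addrI/oppr_inj.
have [ea eb] : sl2_conj P (rho a) = sl2_conj P' (rho' a)
    /\ sl2_conj P (rho b) = sl2_conj P' (rho' b).
  move: AB AB' => [_ AE BE] [_ AE' BE']; split; apply: val_inj.
    exact: etrans AE (esym AE').
  by apply: etrans BE _; rewrite uu; exact: esym BE'.
exists (P'^-1 * P)%g => g.
have conjM (g1 g2 : SL2 F) C : sl2_conj (g1 * g2)%g C = sl2_conj g1 (sl2_conj g2 C).
  by rewrite /sl2_conj invgM !mulgA.
have conjK C : sl2_conj P'^-1%g (sl2_conj P' C) = C.
  by rewrite -conjM mulVg /sl2_conj invg1 mulg1 mul1g.
rewrite -[RHS]/(sl2_conj _ _); move: g.
apply: (@hom_eq _ _ _ rho' (fun g => sl2_conj (P'^-1 * P)%g (rho g))).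
- exact: rep_hom.
- by move=> g h /=; rewrite (rep_hom rho) sl2_conj_hom.
- by case; rewrite conjM ?ea ?eb conjK.
Qed.

End TwistReps.

Local Open Scope complex_scope.

(** * Complex roots of unity and cosines *)

Section Cis.
Variable R : realType.
Implicit Types (s t : R) (z : R[i]).

Definition cis t : R[i] := cos t +i* sin t.

Lemma cis0 : cis 0 = 1.
Proof. by rewrite /cis cos0 sin0. Qed.

Lemma cisD s t : cis (s + t) = cis s * cis t.
Proof. by rewrite /cis cosD sinD; simpc; rewrite [sin s * _ + _]addrC. Qed.

Lemma cis_neq0 t : cis t != 0.
Proof.
apply/negP => /eqP t0; have := cisD t (- t); rewrite t0 mul0r subrr cis0.
by move/eqP; rewrite oner_eq0.
Qed.

Lemma cisV t : (cis t)^-1 = cis (- t).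
Proof. by apply: (mulfI (cis_neq0 t)); rewrite divff ?cis_neq0 // -cisD subrr cis0. Qed.

Lemma cisX t k : cis t ^+ k = cis (t *+ k).
Proof. by elim: k => [|k IHk]; rewrite ?cis0 // exprS IHk -cisD mulrS. Qed.

Lemma cisXz t (j : int) : cis t ^ j = cis (t *~ j).
Proof.
case: j => k; rewrite /exprz ?cisX // cisV.
by rewrite NegzE mulrNz.
Qed.

Lemma cis2pi : cis (pi *+ 2) = 1.
Proof. by rewrite /cis cos2pi sin2pi. Qed.

Lemma cispi : cis pi = -1.
Proof. by rewrite /cis cospi sinpi; apply/eqP; rewrite eq_complex /= oppr0 !eqxx. Qed.

Lemma cis_sum t : cis t + (cis t)^-1 = (2 * cos t)%:C.
Proof.
rewrite cisV /cis cosN sinN; apply/eqP; rewrite eq_complex /= subrr eqxx andbT.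
by rewrite mulr_natl mulr2n.
Qed.

Lemma cis_neq1 t : 0 < t < pi *+ 2 -> cis t != 1.
Proof.
move=> /andP[t0 t2]; apply/negP => /eqP[ct _].
have s0 : 0 < sin (t / 2).
  apply: sin_gt0_pi; rewrite divr_gt0 // ltr_pdivrMr //=.
  by rewrite mulr_natr.
have := cos_mulr2n (t / 2); rewrite (_ : t / 2 *+ 2 = t); last first.
  by rewrite -mulr_natr divfK ?pnatr_eq0.
rewrite ct cos2sin2 mulr2n.
have : 0 < sin (t / 2) ^+ 2 by rewrite exprn_gt0.
lra.
Qed.

Lemma cis_primitive k : k.+1.-primitive_root (cis (pi *+ 2 / k.+1%:R)).
Proof.
rewrite /primitive_root_of_unity /=; apply/forallP => i; rewrite unity_rootE cisX.
have k0 : (k.+1%:R : R) != 0 by rewrite pnatr_eq0.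
have E (j : nat) : (pi *+ 2 / k.+1%:R) *+ j = pi *+ 2 * (j%:R / k.+1%:R) :> R.
  by rewrite -mulr_natr mulrAC mulrA.
rewrite E; case: (ltngtP i.+1 k.+1) => ik; last 2 first.
- by rewrite ltnS ltnNge -ltnS ltn_ord in ik.
- by rewrite ik divff // mulr1 cis2pi eqxx eqxx.
rewrite (negPf (cis_neq1 _)) ?ltn_eqF //.
have p2 : 0 < pi *+ 2 :> R by rewrite mulr2n addr_gt0 ?pi_gt0.
rewrite mulr_gt0 ?divr_gt0 ?ltr0n //= gtr_pMr // ltr_pdivrMr ?ltr0n // mul1r.
by rewrite ltr_nat.
Qed.

Lemma cos_sgn_denom (l N : int) : N != 0 ->
  cos (2 * pi * l%:~R / N%:~R) = cos (2 * pi * l%:~R / `|N|%:~R) :> R.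
Proof.
by case: (ltrP 0 N) => N0 _;
  [rewrite gtr0_norm | rewrite ler0_norm // rmorphN invrN mulrN cosN].
Qed.

Lemma root_of_unity_cos z (N : int) : N != 0 -> z ^ N = 1 -> z != 1 -> z != -1 ->
  exists l : int, [/\ 0 < l, 2 * l < `|N| &
    z + z^-1 = (2 * cos (2 * pi * l%:~R / N%:~R))%:C].
Proof.
move=> N0 zN z1 zN1; have [k kE] : exists k : nat, `|N| = k.+1%:Z.
  by exists (`|N|%N.-1); lia.
have zk : z ^+ k.+1 = 1.
  case: (ltrP 0 N) => N_0; move: kE; first by rewrite gtr0_norm // => kE; rewrite kE in zN.
  rewrite ler0_norm // => /(congr1 -%R); rewrite opprK => kE.
  by move: zN; rewrite kE -invr_expz => /(congr1 GRing.inv); rewrite invrK invr1.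
have [[j jk]] := prim_rootP (cis_primitive k) zk; rewrite /= cisX => zE.
have k0 : (k.+1%:R : R) != 0 by rewrite pnatr_eq0.
have jE : (pi *+ 2 / k.+1%:R) *+ j = 2 * pi * j%:R / k.+1%:R :> R.
  by rewrite -[_ *+ j]mulr_natr -[pi *+ 2]mulr_natl mulrAC.
have j0 : (0 < j)%N by rewrite lt0n; apply: contraNneq z1 => j0; rewrite zE j0 cis0.
have jh : (2 * j != k.+1)%N.
  apply: contraNneq zN1 => jh; rewrite zE jE -jh natrM -cispi; apply/eqP; congr cis.
  have jR : j%:R != 0 :> R by rewrite pnatr_eq0 -lt0n.
  by move: (j%:R : R) jR => r r0; field.
have zs : z + z^-1 = (2 * cos (2 * pi * j%:R / k.+1%:R))%:C by rewrite zE jE cis_sum.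
have [jl|jg] := ltnP (2 * j) k.+1.
  exists j; split; [lia | lia |].
  by rewrite zs cos_sgn_denom // kE.
(* Replacing z by its inverse keeps the cosine and moves the index into the lower half. *)
exists (k.+1 - j)%N; split; [lia | lia |].
rewrite zs cos_sgn_denom // kE; congr (2 * _)%:C.
have -> : 2 * pi * (k.+1 - j)%N%:~R / k.+1%:Z%:~R = - (2 * pi * j%:R / k.+1%:R) + pi *+ 2 :> R.
  rewrite -!pmulrn natrB 1?ltnW //; move: (k.+1%:R : R) k0 => r r0; field; exact: r0.
by rewrite cosD2pi cosN.
Qed.

Lemma cos_root_of_unity (l N : int) : 0 < l -> 2 * l < `|N| ->
  exists z, [/\ z ^ N = 1, z != 1, z != -1 &
    z + z^-1 = (2 * cos (2 * pi * l%:~R / N%:~R))%:C].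
Proof.
move=> l0 lN; have N0 : N != 0 by lia.
have N0R : N%:~R != 0 :> R by rewrite intr_eq0.
pose t : R := 2 * pi * l%:~R / N%:~R.
have st : sin t != 0.
  have MR : 0 < `|N|%:~R :> R by rewrite ltr0z normr_gt0.
  have t'0 : 0 < (2 * pi * l%:~R / `|N|%:~R : R) < pi.
    apply/andP; split; first by rewrite divr_gt0 // !mulr_gt0 ?pi_gt0 ?ltr0z.
    rewrite ltr_pdivrMr // [2 * pi]mulrC -mulrA.
    by rewrite ltr_pM2l ?pi_gt0 // -[2]/(2%:~R) -intrM ltr_int.
  have := sin_gt0_pi t'0; rewrite /t; case: (ltrP 0 N) => N_0.
    by rewrite gtr0_norm // => /gt_eqF ->.
  by rewrite ler0_norm // rmorphN invrN mulrN sinN oppr_gt0 => /lt_eqF ->.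
exists (cis t); rewrite cis_sum; split=> //.
- have -> : cis t ^ N = cis (pi *+ 2) ^ l; last by rewrite cis2pi exp1rz.
  rewrite !cisXz; congr cis.
  by rewrite -[LHS]mulrzr -[RHS]mulrzr /t divfK // -[pi *+ 2]mulr_natl.
- by apply: contraNneq st => -[_ ->].
- by apply: contraNneq st => -[_ ->]; rewrite oppr0.
Qed.

End Cis.

Lemma admissibleE (R : realType) (l N : int) :
  (l%:~R <= (`|N|%:~R - 1) / 2 :> R) = (2 * l < `|N|).
Proof.
rewrite ler_pdivlMr // -[2]/(2%:~R) -[1]/(1%:~R) -intrM -intrB ler_int.
by lia.
Qed.

Theorem theoremA (R : realType) (n : int) :
  let admissible (l : int) : Prop :=
    0 < l /\ l%:~R <= (`|3 * n - 1|%:~R - 1) / 2 :> R in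
  let x (l : int) : R[i] :=
    (1 - 2 * cos (2 * pi * l%:~R / (3 * n - 1)%:~R) : R)%:C in
  let has_params (rho : {multiplicative twist_group n -> SL2 R[i]}) (z : R[i]) :=
    \tr (rho (twist_a n)) = z /\ \tr (rho (twist_a n * twist_b n)%g) = z in
  (forall rho : {multiplicative twist_group n -> SL2 R[i]},
     irreducible_rep rho ->
     (~ acyclic rho <-> exists l, admissible l /\ has_params rho (x l)))
  /\ (forall l, admissible l ->
        exists rho : {multiplicative twist_group n -> SL2 R[i]},
          [/\ irreducible_rep rho, ~ acyclic rho & has_params rho (x l)])
  /\ (forall rho rho' : {multiplicative twist_group n -> SL2 R[i]},
        irreducible_rep rho -> ~ acyclic rho ->
        irreducible_rep rho' -> ~ acyclic rho' ->
        (conjugate_rep rho rho' <->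
           \tr (rho (twist_a n)) = \tr (rho' (twist_a n)) /\
           \tr (rho (twist_a n * twist_b n)%g)
             = \tr (rho' (twist_a n * twist_b n)%g))).
Proof.
move=> admissible x has_params.
have N0 : 3 * n - 1 != 0 by lia.
have xE l (z : R[i]) : z + z^-1 = (2 * cos (2 * pi * l%:~R / (3 * n - 1)%:~R))%:C ->
    x l = 1 - (z + z^-1).
  by move=> ->; rewrite /x rmorphB.
have zeta_of l : admissible l -> exists z : R[i],
    [/\ z ^ (3 * n - 1) = 1, z != 1, z != -1 & x l = 1 - (z + z^-1)].
  move=> [l0]; rewrite admissibleE => lN.
  by have [z [zn z1 zN1 /xE zl]] := cos_root_of_unity R l0 lN; exists z.
have naE (rho : {multiplicative twist_group n -> SL2 R[i]}) : irreducible_rep rho ->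
    ~ acyclic rho <-> exists l, admissible l /\ has_params rho (x l).
  move=> irr; rewrite not_acyclic_zeta //; split=> [[z [zn z1 zN1 xz yz]]|[l [ladm [xl yl]]]].
    have [l [l0 lN /xE zl]] := root_of_unity_cos N0 zn z1 zN1.
    by exists l; split; [split; rewrite // admissibleE | rewrite /has_params zl].
  by have [z [zn z1 zN1 zl]] := zeta_of l ladm; exists z; split; rewrite // -zl.
split=> //; split=> [l ladm|rho rho' irr _ irr' _]; last exact: conjugate_rep_trace.
have [z [zn z1 zN1 zl]] := zeta_of l ladm.
have [rho [irr [_ _ _ xz yz]]] := zeta_rep_ex zn z1 zN1.
have rho_params : has_params rho (x l) by rewrite /has_params zl.
by exists rho; split; rewrite // naE //; exists l.
Qed.
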